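(* Let $w,h\ge 5$ be odd integers, and let $L$ be a hitomezashi loop with width $w$ and height $h$ that is not a rug. Then $$\operatorname{length}(L)\ \le\ (w-1)(h-1)+4.$$ Moreover, equality is achieved if and only if $L$ is a horizontal or vertical comb or, when $\min\{w,h\}=5$, a wand.
   Context: A stitch is a unit-length axis-parallel line segment in $\mathbb R^2$ whose endpoints are in $\mathbb Z^2$. A hitomezashi pattern is a collection of stitches such that every point of $\mathbb Z^2$ is an endpoint of exactly one horizontal stitch and exactly one vertical stitch of the collection. A hitomezashi loop is a bounded connected component of the union of the stitches of a hitomezashi pattern (it is a closed polygon). The longitude (respectively, latitude) of a stitch is the $x$-coordinate (respectively, $y$-coordinate) of its midpoint. The width (respectively, height) of a hitomezashi loop $L$ is the maximum difference between the longitudes (respectively, latitudes) of the stitches in $L$. $\operatorname{length}(L)$ is the number of stitches in $L$. Grid labels: a hitomezashi pattern is encoded by labels $\varepsilon_i,\eta_j\in\mathbb Z/2\mathbb Z$ ($i,j\in\mathbb Z$). The stitches on the horizontal line $y=i$ are the segments from $(k,i)$ to $(k+1,i)$ with $k\equiv\varepsilon_i\pmod 2$, and the stitches on the vertical line $x=j$ are the segments from $(j,k)$ to $(j,k+1)$ with $k\equiv\eta_j\pmod 2$. Below, grid labels are specified for the rectangular region $[0,w]\times[0,h]$, i.e. $\varepsilon_i$ for $0\le i\le h$ and $\eta_j$ for $0\le j\le w$. In each case the resulting pattern in this region has exactly one loop of width $w$ and height $h$, and the named object is this loop, considered modulo translation (so ''$L$ is a rug'' means that $L$ is a translate of it, etc.).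 Rug ($w,h\geq 5$ odd here): $\varepsilon_0=\varepsilon_h=\eta_0=\eta_w=1$, and all other labels equal $0$. Horizontal comb ($w,h\ge5$ odd, $h\equiv 1\pmod 4$, $\alpha$ odd with $3\le\alpha\le w-2$): $\varepsilon_0=\varepsilon_h=0$; for $0<i<h$, $\varepsilon_i=0$ if $i\equiv 2,3\pmod 4$ and $\varepsilon_i=1$ if $i\equiv 0,1\pmod 4$; $\eta_0=\eta_{\alpha-1}=\eta_\alpha=\eta_w=0$; all other vertical labels $\eta_j$ equal $1$. Vertical comb ($w,h\ge5$ odd, $w\equiv1\pmod 4$, $\beta$ odd with $3\le\beta\le h-2$): defined analogously with the two coordinate directions exchanged, i.e. $\eta_0=\eta_w=0$; for $0<j<w$, $\eta_j=0$ if $j\equiv2,3\pmod4$ and $\eta_j=1$ if $j\equiv0,1\pmod 4$; $\varepsilon_0=\varepsilon_{\beta-1}=\varepsilon_\beta=\varepsilon_h=0$; all other $\varepsilon_i$ equal $1$. Wand of width $5$ ($w=5$, $h\ge 5$ odd): $\eta_1=\eta_4=1$, $\eta_0=\eta_2=\eta_3=\eta_5=0$, $\varepsilon_0=\varepsilon_h=0$, $\varepsilon_1=\varepsilon_{h-1}=1$, and $\varepsilon_{2i}=\varepsilon_{2i+1}$ for all integers $i\in[1,(h-3)/2]$, with the requirement that $\varepsilon_{2i}=0$ for at least one $i\in[1,(h-3)/2]$. A wand of height $5$ is a $90^\circ$ rotation of a wand of width $5$. A wand is a wand of width $5$ or a wand of height $5$. *)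

(* Defs.v *)
From HB Require Import structures.
From mathcomp Require Import all_boot all_order all_algebra finmap.
From mathcomp Require Import all_classical all_reals all_analysis.

Set Implicit Arguments.
Unset Strict Implicit.
Unset Printing Implicit Defensive.

Import Order.TTheory GRing.Theory Num.Theory.
Import numFieldNormedType.Exports.

Local Open Scope classical_set_scope.
Local Open Scope ring_scope.

(* [(b, (x, y))] is the stitch from (x, y) to (x + 1, y) if [b = true]
   (horizontal) and from (x, y) to (x, y + 1) if [b = false] (vertical). *)
Definition stitch : choiceType := (bool * (int * int))%type.

Definition horizontal (s : stitch) : bool := s.1.
Definition source (s : stitch) : int * int := s.2.
Definition target (s : stitch) : int * int :=
  if horizontal s then (s.2.1 + 1, s.2.2) else (s.2.1, s.2.2 + 1).

Definition endpoint (s : stitch) (p : int * int) : Prop :=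
  p = source s \/ p = target s.

Definition hitomezashi_pattern (P : set stitch) : Prop :=
  forall p : int * int,
    (exists! s, [/\ P s, horizontal s & endpoint s p]) /\
    (exists! s, [/\ P s, ~~ horizontal s & endpoint s p]).

Section Plane.
Variable R : realType.
Implicit Type L : set (R * R).

(* The box spanned by the two endpoints; it is a segment because a stitch is
   axis-parallel. *)
Definition segment (s : stitch) : set (R * R) :=
  [set p | (source s).1%:~R <= p.1 <= (target s).1%:~R /\
           (source s).2%:~R <= p.2 <= (target s).2%:~R].

Definition stitch_union (P : set stitch) : set (R * R) :=
  \bigcup_(s in P) segment s.

Definition loop_of (P : set stitch) L : Prop :=
  (exists2 x, stitch_union P x & L = connected_component (stitch_union P) x) /\
  bounded_set L.

Definition hitomezashi_loop L : Prop :=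
  exists2 P, hitomezashi_pattern P & loop_of P L.

(* If [L] is a loop of a pattern [P], every unit lattice segment included in
   [L] is a stitch of [P], so there is no need to mention [P] here. *)
Definition stitches L : set stitch := [set s | segment s `<=` L].

(* [stitches L] is finite when [L] is bounded ([fset_set] sends infinite sets
   to the empty set). *)
Definition loop_length L : nat := #|` fset_set (stitches L)|.

Definition longitude (s : stitch) : R :=
  ((source s).1%:~R + (target s).1%:~R) / 2.
Definition latitude (s : stitch) : R :=
  ((source s).2%:~R + (target s).2%:~R) / 2.

Definition is_maximum (A : set R) (m : R) : Prop := A m /\ ubound A m.

Definition has_width L (w : nat) : Prop :=
  is_maximum
    [set longitude s - longitude t | s in stitches L & t in stitches L] w%:R.
Definition has_height L (h : nat) : Prop :=
  is_maximum
    [set latitude s - latitude t | s in stitches L & t in stitches L] h%:R.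

(* Loops live on the lattice, so only translations by lattice vectors matter. *)
Definition translate (v : int * int) L : set (R * R) :=
  [set (p.1 + v.1%:~R, p.2 + v.2%:~R) | p in L].

Definition rotate90 L : set (R * R) := [set (- p.2, p.1) | p in L].

Definition region (w h : nat) : set (R * R) :=
  [set p | 0 <= p.1 <= w%:R /\ 0 <= p.2 <= h%:R].

End Plane.

(* [eps i] is the label of the line y = i and [eta j] that of the line x = j;
   the equalities are congruences modulo 2. *)
Definition label_pattern (eps eta : int -> 'Z_2) : set stitch :=
  [set s | if horizontal s then (source s).1%:~R = eps (source s).2
           else (source s).2%:~R = eta (source s).1].

(* [L] is, up to translation, a loop of width w and height h of the part in
   [0, w] x [0, h] of a pattern whose labels satisfy [labels].  The conditions
   [labels] used below fix only the labels of lines that meet the region; the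
   others play no role since [L0] lies in the region. *)
Definition labelled_loop (R : realType) (w h : nat)
    (labels : (int -> 'Z_2) -> (int -> 'Z_2) -> Prop) (L : set (R * R)) : Prop :=
  exists (eps eta : int -> 'Z_2) (L0 : set (R * R)) (v : int * int),
    [/\ labels eps eta,
        loop_of (label_pattern eps eta) L0,
        L0 `<=` region w h,
        has_width L0 w /\ has_height L0 h &
        L = translate v L0].

Definition rug_labels (w h : nat) (eps eta : int -> 'Z_2) : Prop :=
  (forall i : nat, (i <= h)%N ->
     eps i%:Z = if i \in [:: 0%N; h] then 1 else 0) /\
  (forall j : nat, (j <= w)%N ->
     eta j%:Z = if j \in [:: 0%N; w] then 1 else 0).

Definition comb_labels (w h alpha : nat) (eps eta : int -> 'Z_2) : Prop :=
  [/\ eps 0 = 0 /\ eps h%:Z = 0,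
      forall i : nat, (0 < i < h)%N ->
        eps i%:Z = if (i %% 4)%N \in [:: 2; 3]%N then 0 else 1 &
      forall j : nat, (j <= w)%N ->
        eta j%:Z = if j \in [:: 0; alpha - 1; alpha; w]%N then 0 else 1].

Definition wand5_labels (h : nat) (eps eta : int -> 'Z_2) : Prop :=
  [/\ (eta 1 = 1 /\ eta 4 = 1) /\
        [/\ eta 0 = 0, eta 2 = 0, eta 3 = 0 & eta 5 = 0],
      eps 0 = 0 /\ eps h%:Z = 0,
      eps 1 = 1 /\ eps (h - 1)%N%:Z = 1,
      forall i : nat, (1 <= i <= (h - 3) %/ 2)%N ->
        eps (2 * i)%N%:Z = eps (2 * i + 1)%N%:Z &
      exists2 i : nat, (1 <= i <= (h - 3) %/ 2)%N & eps (2 * i)%N%:Z = 0].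

Section NamedLoops.
Variables (R : realType) (L : set (R * R)).

Definition rug : Prop :=
  exists w h : nat,
    [/\ odd w /\ (5 <= w)%N, odd h /\ (5 <= h)%N &
        labelled_loop w h (rug_labels w h) L].

Definition horizontal_comb : Prop :=
  exists w h alpha : nat,
    [/\ odd w /\ (5 <= w)%N, odd h /\ (5 <= h)%N, h = 1 %[mod 4],
        odd alpha /\ (3 <= alpha <= w - 2)%N &
        labelled_loop w h (comb_labels w h alpha) L].

Definition vertical_comb : Prop :=
  exists w h beta : nat,
    [/\ odd w /\ (5 <= w)%N, odd h /\ (5 <= h)%N, w = 1 %[mod 4],
        odd beta /\ (3 <= beta <= h - 2)%N &
        labelled_loop w h (fun eps eta => comb_labels h w beta eta eps) L].

Definition wand_of_width5 : Prop :=
  exists h : nat,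
    [/\ odd h, (5 <= h)%N & labelled_loop 5 h (wand5_labels h) L].

End NamedLoops.

(* The labels of wands of width 5 are stable under reflection in both
   coordinate directions, so the sense of rotation does not matter; the
   translation absorbs the choice of centre. *)
Definition wand_of_height5 (R : realType) (L : set (R * R)) : Prop :=
  exists2 L0, wand_of_width5 L0 & exists v, L = translate v (rotate90 L0).

Definition wand (R : realType) (L : set (R * R)) : Prop :=
  wand_of_width5 L \/ wand_of_height5 L.

(* Main.v *)
Require Import Defs.
From mathcomp Require Import all_boot all_order all_algebra finmap.
From mathcomp Require Import all_classical all_reals all_analysis.
From mathcomp Require Import zify lra.

Set Implicit Arguments.
Unset Strict Implicit.
Unset Printing Implicit Defensive.

Import Order.TTheory GRing.Theory Num.Theory.
Import numFieldNormedType.Exports.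

Local Open Scope classical_set_scope.
Local Open Scope ring_scope.

(** Heights.  Number the columns of unit cells by a walk [F] and the rows by a
walk [G], both with steps 1 and -1.  The signs of the steps can be chosen so
that a unit edge is a stitch exactly when the larger of the sums [F + G] on
its two sides has a fixed parity ([alternating_heights]).  This larger sum
does not change along a component of the pattern, so a loop is a component of
a contour line of [F x + G y], at some level [l].

Shape.  A loop crosses every column and every row of cells of its bounding
box.  A closed curve cannot cross a row only once, because both matchings of
the lattice points (by horizontal and by vertical stitches) exchange the two
colours of the checkerboard ([no_single_exit]).  Comparing the extreme values
of [F] and [G] on the box, one finds that, possibly after exchanging the two
sides of the contour, [F] and [G] are excursions: each starts and ends at its
minimum, steps below it on both sides of the box, and
[min F + max G = max F + min G = l] ([spans_mound]).  With the box moved to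
[[0, w] x [0, h]] and both minima shifted to 0, both maxima are equal to
[n = l], and the labels of the lines are the parities of [top F x - n] and
[top G y - n], where [top F x] is the larger height beside the line [x].

Bound.  The length of a loop is the number of lattice points on it, and those
satisfy [top F x + top G y = n] or [n + 1].  If [n = 1] the loop is a rug.
If [n >= 2], let [a] and [b] be the numbers of lines with [top F x = n], resp.
[top G y = n].  On the border of the box a contour point lies on one of these
lines, which leaves at most [2 a + 2 b] points, and inside the box the [a b]
intersections of these lines are not on the contour.  The total is at most
[(w - 1) (h - 1) + 4 - (a - 2) (b - 2)], and [a, b >= 2] since a peak of a
walk has two sides ([card_orbit_in]).

Equality.  Equality forces [n = 2], a single peak of [F] (or of [G]), and that
the loop passes through all contour points of the box.  Say that [F] has a
single peak.  If [w = 5] then [F] is 0, 1, 2, 1, 0 and the loop is a wand.  If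
[w >= 7] and [G] takes the same value on both sides of a row of height 1, then
some unit square of the box is a contour on its own: an island if this value
is 0, a hole if it is 2.  Hence [G] runs through 0, 1, 2, 1, 0, ... and the
loop is a comb ([fills_zigzag]).  Conversely, another contour component in the
box would also have the shape described above, and with a single peak of
height 2 it could only be such a unit square ([zigzag_fills]). *)

(** * Walks whose contour lines cross every row and column of a box *)

Implicit Types (F G : int -> int) (x y z i j k l m p q : int).

Definition walk F := forall x, F x = F (x - 1) + 1 \/ F x = F (x - 1) - 1.

(** The larger height beside the line [x], which separates the cells numbered
    [x - 1] and [x]. *)
Definition top F x := Num.max (F (x - 1)) (F x).

(** In a contour of level [l], the equation [F j + top G y = l] holds for the
    horizontal stitches, which cross column [j] on the line [y]. *)
Definition crosses F G (l x0 x1 y0 y1 : int) : Prop :=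
  (forall j, x0 <= j < x1 -> exists y y', [/\ y0 <= y <= y1, y0 <= y' <= y1,
     y != y', F j + top G y = l & F j + top G y' = l]) /\
  (forall y, y0 <= y <= y1 -> exists2 j : int, x0 <= j < x1 & F j + top G y = l).

Definition arch F (x0 x1 : int) : Prop :=
  [/\ F x0 = F (x1 - 1), forall j, x0 <= j < x1 -> F x0 <= F j,
      F (x0 - 1) = F x0 - 1 & F x1 = F (x1 - 1) - 1].

Definition max_on F (x0 x1 m : int) : Prop :=
  (forall j, x0 <= j < x1 -> F j <= m) /\ exists2 j : int, x0 <= j < x1 & F j = m.

Definition mound F G (l x0 x1 y0 y1 : int) : Prop :=
  [/\ arch F x0 x1, arch G y0 y1,
      max_on F x0 x1 (l - G y0) & max_on G y0 y1 (l - F x0)].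

Lemma mound_swap F G l x0 x1 y0 y1 :
  mound F G l x0 x1 y0 y1 -> mound G F l y0 y1 x0 x1.
Proof. by case=> *; split. Qed.

Lemma argmin F (x0 x1 : int) : x0 < x1 ->
  exists2 m, x0 <= m < x1 & forall j, x0 <= j < x1 -> F m <= F j.
Proof.
move=> ltx; have [n ->] : exists n : nat, x1 = x0 + n.+1%:Z.
  by exists (absz (x1 - x0 - 1)%R); lia.
elim: n => [|n [m m_in mP]].
  by exists x0 => [|j ?]; [lia | have -> : j = x0 by lia].
have [le_m|lt_m] := leP (F m) (F (x0 + n.+1%:Z)).
  exists m => [|j j_in]; first by lia.
  have [->//|ne_j] := eqVneq j (x0 + n.+1%:Z); apply: mP; lia.
exists (x0 + n.+1%:Z) => [|j j_in]; first by lia.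
have [->//|ne_j] := eqVneq j (x0 + n.+1%:Z).
by apply: le_trans (ltW lt_m) _; apply: mP; lia.
Qed.

Lemma argmax F (x0 x1 : int) : x0 < x1 ->
  exists2 m, x0 <= m < x1 & forall j, x0 <= j < x1 -> F j <= F m.
Proof.
move=> /(argmin (fun x => - F x)) [m m_in mP].
by exists m => // j /mP; lia.
Qed.

Section Spans.
Variables (F G : int -> int) (l x0 x1 y0 y1 : int).
Hypotheses (walkF : walk F) (ltx : x0 < x1) (lty : y0 < y1).
Hypotheses (FG : crosses F G l x0 x1 y0 y1) (GF : crosses G F l y0 y1 x0 x1).

(** The row where [G] attains [q] is crossed twice by the contour.  On a line
    strictly inside the box, [top F] exceeds the minimum [l - q] of [F], so the
    two crossings lie on the two vertical sides of the box. *)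
Lemma arch_of_max q : (forall j, x0 <= j < x1 -> l - q <= F j) ->
  (exists2 i : int, y0 <= i < y1 & G i = q) -> arch F x0 x1 /\ F x0 = l - q.
Proof.
move=> Fge [i i_in Gi]; have [x [x' [x_in x'_in xx']]] := GF.1 i i_in.
rewrite Gi => topx topx'.
have ends z : x0 <= z <= x1 -> q + top F z = l -> z = x0 \/ z = x1.
  move=> z_in topz; have [?|nx0] := eqVneq z x0; first by left.
  have [?|nx1] := eqVneq z x1; first by right.
  exfalso; have := Fge z; have := Fge (z - 1); have := walkF z; move: topz.
  by rewrite /top; lia.
have [e0 e1] : q + top F x0 = l /\ q + top F x1 = l.
  have := ends x x_in topx; have := ends x' x'_in topx'.
  move: topx topx' xx' => /[swap].
  by move=> topx' topx ne [] e' [] e; move: topx topx' ne; rewrite e e' ?eqxx.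
have := Fge x0; have := Fge (x1 - 1); have := walkF x0; have := walkF x1.
move: e0 e1; rewrite /top => e0 e1 w1 w0 f1 f0.
have F0 : F x0 = l - q by lia.
by split=> //; split; [lia | rewrite F0 | lia | lia].
Qed.

(** The line [y] at which the lowest column is crossed bounds a row of the box
    whose height is at least [top G y - 1 = l - m - 1]. *)
Lemma min_max_level : walk G -> exists m q,
  [/\ forall j, x0 <= j < x1 -> m <= F j, forall i, y0 <= i < y1 -> G i <= q,
      exists2 j : int, x0 <= j < x1 & F j = m, exists2 i : int, y0 <= i < y1
        & G i = q &
      m + q = l \/ m + q = l - 1].
Proof.
move=> walkG; have [jm jm_in jmP] := argmin F ltx.
have [ip ip_in ipP] := argmax G lty.
exists (F jm), (G ip); split=> //; [by exists jm | by exists ip |].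
have [y [_ [y_in _ _ Fy _]]] := FG.1 jm jm_in.
have [j j_in jP] := FG.2 ip ltac:(lia).
have := jmP j j_in; have := walkG y; move: Fy jP; rewrite /top.
have [yy0|yy0] := eqVneq y y0; first by have := ipP y; lia.
by have := ipP (y - 1); have := walkG ip; have := ipP y; lia.
Qed.

(** Once [F] is an arch, [top F] is bounded on the box by the maximum of [F],
    so the crossing of the lowest row shows that [max F + min G = l]; this is
    the hypothesis of [arch_of_max] with the roles of [F] and [G] exchanged. *)
Lemma max_of_arch : arch F x0 x1 -> exists p, max_on F x0 x1 p /\
  ((forall i, y0 <= i < y1 -> l - p <= G i) /\
   exists2 i : int, y0 <= i < y1 & G i = l - p).
Proof.
case=> Fe Fge Fl Fr; have [im im_in imP] := argmin G lty.
have le_p j : x0 <= j < x1 -> F j <= l - G im.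
  move=> /FG.1[y [_ [y_in _ _ Fy _]]]; move: Fy; rewrite /top.
  by have := imP y; have := imP (y - 1); lia.
exists (l - G im); split; last first.
  by split; [move=> i /imP; lia | exists im => //; lia].
split=> //; have [jp jp_in jpP] := argmax F ltx; exists jp => //.
have := le_p _ jp_in; have [x [_ [x_in _ _ Fx _]]] := GF.1 im im_in.
have [xx0|xx0] := eqVneq x x0; move: Fx; rewrite /top.
  by have := jpP x; rewrite xx0; lia.
have [xx1|xx1] := eqVneq x x1; first by have := jpP (x - 1); rewrite xx1; lia.
by have := jpP x; have := jpP (x - 1); lia.
Qed.

End Spans.

Lemma mound_of_max F G l x0 x1 y0 y1 q : walk F -> walk G -> x0 < x1 ->
  y0 < y1 -> crosses F G l x0 x1 y0 y1 -> crosses G F l y0 y1 x0 x1 ->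
  (forall j, x0 <= j < x1 -> l - q <= F j) ->
  (exists2 i : int, y0 <= i < y1 & G i = q) -> mound F G l x0 x1 y0 y1.
Proof.
move=> wF wG ltx lty FG GF Fge Gq.
have [aF eF] := arch_of_max wF ltx lty GF Fge Gq.
have [p [tF [Gge [i i_in Gi]]]] := max_of_arch ltx lty FG GF aF.
have Fp : exists2 j : int, x0 <= j < x1 & F j = p by case: tF.
have [aG eG] := arch_of_max wG lty ltx FG Gge Fp.
split=> //; first by rewrite eG; have -> : l - (l - p) = p by lia.
have [q' [tG [_ [j j_in Fj]]]] := max_of_arch lty ltx GF FG aG.
suff -> : l - F x0 = q' by [].
by have := Fge j j_in; case: tG => tG1 [i' i'_in ?]; case: Gq => k /tG1; lia.
Qed.

(** Negating the heights exchanges the two sides of a contour.  The extra [- 1]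
    in one of the two walks is needed because the level of a stitch is the
    larger of the two sums beside it: for the opposite sums, [- l + 1] and [- l]
    have to become [- l] and [- l - 1]. *)
Definition flip F x : int := - F x.
Definition flip1 F x : int := - 1 - F x.

Lemma top_flip F x : walk F -> top (flip F) x = 1 - top F x.
Proof. by move=> /(_ x); rewrite /top /flip; lia. Qed.

Lemma top_flip1 F x : walk F -> top (flip1 F) x = - top F x.
Proof. by move=> /(_ x); rewrite /top /flip1; lia. Qed.

Lemma walk_flip F : walk F -> walk (flip F).
Proof. by move=> wF x; have := wF x; rewrite /flip; lia. Qed.

Lemma walk_flip1 F : walk F -> walk (flip1 F).
Proof. by move=> wF x; have := wF x; rewrite /flip1; lia. Qed.

(** By [min_max_level] the sum [min G + max F] is [l] or [l - 1].  The first
    case is [mound_of_max]; in the second, the flipped heights satisfy its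
    hypothesis. *)
Lemma spans_mound F G l x0 x1 y0 y1 : walk F -> walk G -> x0 < x1 -> y0 < y1 ->
  crosses F G l x0 x1 y0 y1 -> crosses G F l y0 y1 x0 x1 ->
  mound F G l x0 x1 y0 y1 \/ mound (flip F) (flip1 G) (- l) x0 x1 y0 y1.
Proof.
move=> wF wG ltx lty FG GF.
have [m [q [mP qP [i i_in Gi] [j j_in Fj] e]]] := min_max_level lty ltx GF wF.
case: e => e; [left; apply: mound_swap; apply: mound_of_max GF FG _ _ | right].
- by [].
- by [].
- by [].
- by [].
- by move=> i' /mP; instantiate (1 := q); lia.
- by exists j.
apply: (@mound_of_max _ _ _ _ _ _ _ (- 1 - m)) => //.
- exact: walk_flip.
- exact: walk_flip1.
- split=> [k|y] k_in.
    have [y [y' [? ? ? ? ?]]] := FG.1 k k_in; exists y, y'.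
    by split=> //; rewrite top_flip1 // /flip; lia.
  by have [k ? ?] := FG.2 y k_in; exists k; rewrite ?top_flip1 // /flip; lia.
- split=> [k|y] k_in.
    have [y [y' [? ? ? ? ?]]] := GF.1 k k_in; exists y, y'.
    by split=> //; rewrite top_flip // /flip1; lia.
  by have [k ? ?] := GF.2 y k_in; exists k; rewrite ?top_flip // /flip1; lia.
- by move=> k /qP; rewrite /flip; lia.
- by exists i => //; rewrite /flip1; lia.
Qed.

(** * Components of a contour *)

Section Parity.
Local Open Scope fset_scope.

Lemma colored_card (T : choiceType) (A : {fset T}) (c : T -> bool) (f : T -> T) :
  {in A, forall u, f u \in A} -> {in A, forall u, f (f u) = u} ->
  {in A, forall u, c (f u) = ~~ c u} ->
  #|` [fset u in A | c u]| = #|` [fset u in A | ~~ c u]|.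
Proof.
move=> fA fK fc.
have le d : (forall u, u \in A -> d (f u) = ~~ d u) ->
    (#|` [fset u in A | d u]| <= #|` [fset u in A | ~~ d u]|)%N.
  move=> fd; have <- : #|` [fset f u | u in [fset u in A | d u]]| =
      #|` [fset u in A | d u]|.
    apply: card_in_imfset => u w; rewrite !inE => /andP[/= Au _] /andP[/= Aw _] e.
    by rewrite -(fK u Au) e fK.
  apply: fsubset_leq_card; apply/fsubsetP => w /imfsetP[u /=].
  by rewrite !inE => /andP[/= Au du] ->; rewrite fA //= fd // du.
apply/eqP; rewrite eqn_leq le //=.
have := le (fun u => ~~ c u);
  rewrite (_ : [fset u in A | ~~ ~~ c u] = [fset u in A | c u])%fset.
  by apply=> u Au; rewrite fc.
by apply/fsetP => u; rewrite !inE negbK.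
Qed.

(** If [f] is a colour-exchanging involution of [A], then [A] has as many
    points of one colour as of the other; hence [g] cannot be such an involution
    of [A] minus one point. *)
Lemma no_single_exit (T : choiceType) (A : {fset T}) (c : T -> bool)
    (f g : T -> T) (e : T) : e \in A ->
  {in A, forall u, f u \in A} -> {in A, forall u, f (f u) = u} ->
  {in A, forall u, c (f u) = ~~ c u} ->
  {in A `\ e, forall u, g u \in A `\ e}%fset ->
    {in A `\ e, forall u, g (g u) = u}%fset ->
  {in A `\ e, forall u, c (g u) = ~~ c u}%fset -> False.
Proof.
move=> eA fA fK fc gA gK gc.
have e1 := colored_card fA fK fc; have := colored_card gA gK gc.
have D d : [fset u in (A `\ e)%fset | d u]%fset = ([fset u in A | d u] `\ e)%fset.
  by apply/fsetP => u; rewrite !inE; case: eqP.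
rewrite !D.
have := cardfsD1 e [fset u in A | c u]%fset;
  have := cardfsD1 e [fset u in A | ~~ c u]%fset.
rewrite !inE eA /=; case: (c e) => /=; lia.
Qed.

End Parity.

Implicit Types (u v : int * int) (S Q : set (int * int)).

(** The other endpoint of the horizontal stitch at the lattice point [v]. *)
Definition hn F G l v : int * int :=
  if (2 %| F v.1 + top G v.2 - l)%Z then (v.1 + 1, v.2) else (v.1 - 1, v.2).

Definition flipxy v : int * int := (v.2, v.1).

Definition vn F G l v := flipxy (hn G F l (flipxy v)).

Definition level F G l v := l <= top F v.1 + top G v.2 <= l + 1.

Definition stable F G l Q := forall v, Q v -> Q (hn F G l v) /\ Q (vn F G l v).

(** Being in every stable set that contains [v] amounts to being linked to [v]
    by a path of stitches; a property of the whole orbit is then proved by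
    exhibiting a stable set. *)
Definition orbit F G l v u := forall Q, stable F G l Q -> Q v -> Q u.

Lemma hnK F G l : walk F -> involutive (hn F G l).
Proof.
move=> wF [x y]; rewrite {2}/hn /=; have := wF x; have := wF (x + 1).
rewrite addrK; case: ifPn => d1 wp w; rewrite /hn /=; case: ifPn => d2;
  rewrite ?addrK ?subrK //; exfalso; lia.
Qed.

Lemma vnK F G l : walk G -> involutive (vn F G l).
Proof.
by move=> wG v; rewrite /vn /flipxy /= -surjective_pairing hnK //=
  -surjective_pairing.
Qed.

(** The heights of the four cells around a lattice point are [s], [s + 1],
    [s + 2], [s + 1] in cyclic order, for some [s].  The two stitches there are
    the edges beside the lowest cell, both of level [s + 1], or those beside the
    highest one, both of level [s + 2]. *)
Lemma hn_level F G l v : walk F -> walk G -> level F G l v ->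
  level F G l (hn F G l v) /\
  ((hn F G l v = (v.1 + 1, v.2) /\ F v.1 + top G v.2 = l) \/
   (hn F G l v = (v.1 - 1, v.2) /\ F (v.1 - 1) + top G v.2 = l)).
Proof.
case: v => x y wF wG; rewrite /level /hn /=.
have := wF x; have := wF (x + 1); have := wF (x - 1); rewrite addrK.
case: ifPn => /=; move: (top G y) => t dv; rewrite /top ?addrK => wm wp w lv.
  by split; [lia | left; split => //; lia].
by split; [lia | right; split => //; lia].
Qed.

Lemma level_swap F G l v : level G F l (flipxy v) = level F G l v.
Proof. by rewrite /level /= addrC. Qed.

Definition component F G l S :=
  [/\ forall v, S v -> level F G l v, stable F G l S &
      forall Q u, stable F G l Q -> S u -> Q u -> forall v, S v -> Q v].

Definition swapped S : set (int * int) := fun v => S (flipxy v).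

Lemma stable_swap F G l S : stable F G l S -> stable G F l (swapped S).
Proof.
move=> st v /st; rewrite /swapped /vn /flipxy /= => -[].
by rewrite -!surjective_pairing.
Qed.

Lemma component_swap F G l S : component F G l S -> component G F l (swapped S).
Proof.
case=> lev st cn; split; first by move=> v /lev; rewrite level_swap.
  exact: (@stable_swap F G l S st).
move=> Q u stQ Su Qu v Sv.
have := cn _ (flipxy u) (@stable_swap G F l Q stQ) Su.
by case: u v Su Qu Sv => ux uy [vx vy] Su Qu Sv /(_ Qu _ Sv).
Qed.

Lemma orbit_stable F G l v : stable F G l (orbit F G l v).
Proof. by move=> u ou; split=> Q stQ Qv; have [] := stQ u (ou Q stQ Qv). Qed.

Lemma orbit_component F G l v : walk F -> walk G -> level F G l v ->
  component F G l (orbit F G l v).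
Proof.
move=> wF wG lv; split.
- move=> u ou; apply: (ou (level F G l)) => // w lw; split;
    first by case: (hn_level wF wG lw).
  rewrite -level_swap; have lw' : level G F l (flipxy w) by rewrite level_swap.
  rewrite /vn {1}/flipxy /=; case: (hn_level wG wF lw') => + _.
  by rewrite {1}(surjective_pairing (hn _ _ _ _)).
- exact: orbit_stable.
move=> Q u stQ ou Qu w ow.
have ouv : orbit F G l u v.
  apply: (ou (fun u => orbit F G l u v)) => // t ot.
  split=> R stR Rt; apply: ot => //.
    by rewrite -(hnK G l wF t); have [] := stR _ Rt.
  by rewrite -(vnK F l wG t); have [] := stR _ Rt.
by apply: ow => //; apply: ouv.
Qed.

Definition bbox S (x0 x1 y0 y1 : int) :=
  [/\ forall u, S u -> x0 <= u.1 <= x1 /\ y0 <= u.2 <= y1,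
      exists y, S (x0, y), exists y, S (x1, y),
      exists x, S (x, y0) & exists x, S (x, y1)].

Lemma bbox_swap S (x0 x1 y0 y1 : int) :
  bbox S x0 x1 y0 y1 -> bbox (swapped S) y0 y1 x0 x1.
Proof. by case=> b *; split=> // u /b []. Qed.

Lemma bbox_finite S (x0 x1 y0 y1 : int) :
  (forall u, S u -> x0 <= u.1 <= x1 /\ y0 <= u.2 <= y1) -> finite_set S.
Proof.
move=> b.
pose f (n : nat * nat) := (x0 + n.1%:Z, y0 + n.2%:Z).
have fin : finite_set [set f n
  | n in (`I_(absz (x1 - x0)).+1 `*` `I_(absz (y1 - y0)).+1)%classic].
  exact/finite_image/finite_setX.
apply: sub_finite_set fin => -[x y] /b /= [xb yb].
exists (absz (x - x0)%R, absz (y - y0)%R) => /=; last by rewrite /f /=;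
  congr pair; lia.
by split => /=; lia.
Qed.

Section Crossings.
Variables (F G : int -> int) (l x0 x1 y0 y1 : int) (S : set (int * int)).
Hypotheses (walkF : walk F) (walkG : walk G).
Hypotheses (compS : component F G l S) (bS : bbox S x0 x1 y0 y1).

Lemma hn_lines v : (hn F G l v).2 = v.2 /\
  ((hn F G l v).1 = v.1 + 1 \/ (hn F G l v).1 = v.1 - 1).
Proof. by rewrite /hn; case: ifP => _ /=; split=> //; [left|right]. Qed.

Lemma vn_lines v : (vn F G l v).1 = v.1 /\
  ((vn F G l v).2 = v.2 + 1 \/ (vn F G l v).2 = v.2 - 1).
Proof. by rewrite /vn /hn; case: ifP => _ /=; split=> //; [left|right]. Qed.

Lemma column_crossed j : x0 <= j < x1 ->
  exists y, S (j, y) /\ hn F G l (j, y) = (j + 1, y).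
Proof.
case: compS bS => lev st cn [b [yl Sl] [yr Sr] _ _] j_in.
apply: contrapT => no_cross.
pose Q : set (int * int) := fun u => S u /\ u.1 <= j.
have stQ : stable F G l Q.
  move=> [x y] [/= Su le_j]; have [Sh Sv] := st _ Su; split; split=> //=.
    have := hn_lines (x, y); move E : (hn F G l (x, y)) => w [/= w2 [w1|w1]];
      last by lia.
    have [ej|?] := eqVneq x j; last by lia.
    case: no_cross; exists y; rewrite -ej E; split=> //.
    by case: w w1 w2 {E} => /= a b' -> ->.
  by have [/= e _] := vn_lines (x, y); rewrite /= e.
have [|_] := cn Q (x0, yl) stQ Sl _ _ Sr; first by split => //=; lia.
by rewrite /=; lia.
Qed.

(** Suppose that [y] is the only crossing.  In the part of the component to the
    right of column [j], the vertical stitches match all the points and the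
    horizontal stitches all but [(j + 1, y)], which contradicts
    [no_single_exit]. *)
Lemma column_crossed_twice j : x0 <= j < x1 -> exists y y', [/\ y != y',
  S (j, y), S (j, y'), hn F G l (j, y) = (j + 1, y)
    & hn F G l (j, y') = (j + 1, y')].
Proof.
move=> j_in; have [y [Sy hy]] := column_crossed j_in.
case: compS bS => lev st cn [b _ _ _ _].
apply: contrapT => no2.
have uniq_y y' : S (j, y') -> hn F G l (j, y') = (j + 1, y') -> y' = y.
  move=> Sy' hy'; apply/eqP/negPn/negP => ne; apply: no2; exists y, y'.
  by rewrite eq_sym.
pose A := fset_set [set u | S u /\ j < u.1].
have AP u : (u \in A) = `[< S u /\ j < u.1 >].
  by rewrite in_fset_set //; apply: sub_finite_set (bbox_finite b) => w [].
pose c u := (2 %| u.1 + u.2)%Z.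
have ch u : c (hn F G l u) = ~~ c u.
  by rewrite /c; have := hn_lines u; lia.
have cv u : c (vn F G l u) = ~~ c u.
  by rewrite /c; have := vn_lines u; lia.
apply: (@no_single_exit _ A c (vn F G l) (hn F G l) (j + 1, y)).
- by rewrite AP; apply/asboolP; rewrite -hy; split;
    [have [] := st _ Sy | rewrite hy /=; lia].
- move=> u; rewrite !AP => /asboolP[Su lt_j]; apply/asboolP.
  by split; [have [] := st _ Su | have [-> _] := vn_lines u].
- by move=> u _; rewrite vnK.
- by [].
- move=> [x' y']; rewrite !inE !AP => /andP[ne /asboolP[/= Su lt_j]].
  have [Sh _] := st _ Su; apply/andP; split.
    apply/eqP => e; have := hnK G l walkF (x', y'); rewrite e -hy hnK // => -[ex _].
    by rewrite -ex ltxx in lt_j.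
  apply/asboolP; split=> //; rewrite ltNge; apply/negP => le_j.
  have [h2 h1] := hn_lines (x', y'); case/eqP: ne.
  have [eh ex] : (hn F G l (x', y')).1 = j /\ x' = j + 1 by move: h1 => /=; lia.
  have ehn : hn F G l (x', y') = (j, y') by rewrite [LHS]surjective_pairing h2 eh.
  congr pair => //; apply: uniq_y; first by rewrite -ehn.
  by rewrite -ehn hnK // ex.
- by move=> u _; rewrite hnK.
- by [].
Qed.

End Crossings.

Lemma crosses_of_component F G l S (x0 x1 y0 y1 : int) : walk F -> walk G ->
  component F G l S -> bbox S x0 x1 y0 y1 -> x0 < x1 /\ crosses F G l x0 x1 y0 y1.
Proof.
move=> wF wG cS bS; case: (cS) (bS) =>
  lev st cn [b [yl Sl] [yr Sr] [xb Sb] [xt St]].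
have side u : S u -> exists2 j : int, x0 <= j < x1 & F j + top G u.2 = l.
  move=> Su; have [Sh _] := st _ Su;
    have [_ [[e ?]|[e ?]]] := hn_level wF wG (lev _ Su).
    by exists u.1 => //; have := b _ Su; have := b _ Sh; rewrite e /=; lia.
  by exists (u.1 - 1) => //; have := b _ Su; have := b _ Sh; rewrite e /=; lia.
split; first by have [j ? _] := side _ Sl; lia.
split=> [j j_in|y y_in].
  have [y [y' [ne Sy Sy' hy hy']]] := column_crossed_twice wF wG cS bS j_in.
  have lv t : S (j, t) -> hn F G l (j, t) = (j + 1, t) -> F j + top G t = l.
    move=> Su e; have [_ [[_ //]|[e' _]]] := hn_level wF wG (lev _ Su).
    by move: e'; rewrite e /= => -[]; lia.
  by exists y, y'; split=> //; [have [] := b _ Sy | have [] := b _ Sy'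
    | exact: lv | exact: lv].
have [->|ne] := eqVneq y y1; first exact: side St.
have [|x [Sx _]] := column_crossed (component_swap cS) (bbox_swap bS) (_ :
  y0 <= y < y1).
  by lia.
exact: side Sx.
Qed.

Lemma component_mound F G l S (x0 x1 y0 y1 : int) : walk F -> walk G ->
  component F G l S -> bbox S x0 x1 y0 y1 ->
  mound F G l x0 x1 y0 y1 \/ mound (flip F) (flip1 G) (- l) x0 x1 y0 y1.
Proof.
move=> wF wG cS bS.
have [ltx FG] := crosses_of_component wF wG cS bS.
have [lty GF] := crosses_of_component wG wF (component_swap cS) (bbox_swap bS).
exact: spans_mound.
Qed.

(** * Heights of a pattern *)

Implicit Types (P : set stitch) (eps eta : int -> 'Z_2) (s t : stitch).

Definition alternating P := forall x y,
  (P (true, (x, y)) <-> ~ P (true, (x - 1, y))) /\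
  (P (false, (x, y)) <-> ~ P (false, (x, y - 1))).

Definition encodes P F G l :=
  (forall x y, P (true, (x, y)) <-> (2 %| F x + top G y - l)%Z) /\
  (forall x y, P (false, (x, y)) <-> (2 %| top F x + G y - l)%Z).

Lemma hitomezashi_alternating P : hitomezashi_pattern P -> alternating P.
Proof.
move=> hP x y; have [[sh [[Ph hh eh] uh]] [sv [[Pv hv ev] uv]]] := hP (x, y).
split; split.
- move=> P1 P2; have e1 : sh = (true, (x, y)) by apply: uh; split=> //; left.
  have e2 : sh = (true, (x - 1, y)).
    by apply: uh; split=> //; right; rewrite /target /= subrK.
  by move: e2; rewrite e1 => -[]; lia.
- move=> nP; case: sh Ph hh eh {uh} => [[] [a b]] // Ph _ [[-> ->] //|[ea eb]].
  by case: nP; rewrite ea addrK eb.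
- move=> P1 P2; have e1 : sv = (false, (x, y)) by apply: uv; split=> //; left.
  have e2 : sv = (false, (x, y - 1)).
    by apply: uv; split=> //; right; rewrite /target /= subrK.
  by move: e2; rewrite e1 => -[]; lia.
- move=> nP; case: sv Pv hv ev {uv} => [[] [a b]] // Pv _ [[-> ->] //|[ea eb]].
  by case: nP; rewrite ea eb addrK.
Qed.

Lemma int_step_ind (K : int -> Prop) :
  K 0 -> (forall x, K (x - 1) <-> K x) -> forall x, K x.
Proof.
move=> K0 Ks; case=> n; elim: n => [|n IHn] //.
- by apply/Ks; rewrite (_ : _ - 1 = Posz n) //; lia.
- by rewrite (_ : Negz 0%N = 0 - 1) //; apply/Ks.
- by rewrite (_ : Negz n.+1 = Negz n - 1) ?NegzE; [apply/Ks; rewrite -NegzE | lia].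
Qed.

Lemma alternate_parity (b : int -> Prop) : (forall x, b x <-> ~ b (x - 1)) ->
  forall x, b x <-> (b 0 <-> (2 %| x)%Z).
Proof.
move=> bs; apply: int_step_ind => [|x]; first by split=> [?|[_ b0]];
  [split | apply: b0].
have -> : (2 %| x - 1)%Z = ~~ (2 %| x)%Z by lia.
have ff : ~ is_true false by [].
have tt : is_true true by [].
have := bs x; have [] := pselect (b (x - 1)); have [] := pselect (b 0).
all: by case: (2 %| x)%Z => /=; tauto.
Qed.

Lemma walk_of_signs (t : int -> bool) : exists F,
  [/\ walk F, F 0 = 0 & forall x, F x = F (x - 1) + (if t x then 1 else - 1)].
Proof.
pose sg x : int := if t x then 1 else - 1.
pose F x : int := match x with
  | Posz n => iteri n (fun d a => a + sg d.+1%:Z) 0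
  | Negz n => iteri n.+1 (fun d a => a - sg (- d%:Z)) 0 end.
have Fs x : F x = F (x - 1) + sg x.
  case: x => [[|n]|n].
  - by rewrite (_ : Posz 0%N - 1 = Negz 0%N) // /F /= sub0r addNr.
  - by rewrite (_ : Posz n.+1 - 1 = Posz n) //; lia.
  - rewrite (_ : Negz n - 1 = Negz n.+1) //; last by lia.
    by rewrite NegzE /F /= subrK.
exists F; split=> // x.
by rewrite (Fs x) /sg; case: ifP; [left | right].
Qed.

Lemma walk_parity F x : walk F -> (2 %| F x - F 0 - x)%Z.
Proof.
by move=> wF; elim/int_step_ind: x => [|x];
  [rewrite subrr | split; have := wF x; lia].
Qed.

(** The parity of [F x] is that of [x], so [top F x] is even exactly when the
    step into [x] goes up with [x] even or down with [x] odd. *)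
Lemma heights_of_signs (b : int -> Prop) : exists F, [/\ walk F, F 0 = 0 &
  forall x, b x <-> (2 %| top F x)%Z].
Proof.
have [F [wF F0 Fs]] := walk_of_signs (fun x => `[< b x >] == (2 %| x)%Z).
exists F; split=> // x; have := Fs x; have := walk_parity x wF; rewrite F0 /top.
case: asboolP => bx; case: ifP => /= e d f; split=> // ; lia.
Qed.

Lemma alternating_heights P v : alternating P ->
  exists F G l, [/\ walk F, walk G, encodes P F G l & level F G l v].
Proof.
move=> aP.
have [F [wF F0 Ft]] := heights_of_signs (fun x => P (false, (x, 0))).
have [G [wG G0 Gt]] := heights_of_signs (fun y => P (true, (0, y))).
pose h := top F v.1 + top G v.2.
(* The levels are the even numbers, since the walks start at 0. *)
exists F, G, (if (2 %| h)%Z then h else h - 1); split=> //; last first.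
  by rewrite /level -/h; case: ifP; lia.
have even_l : (2 %| if (2 %| h)%Z then h else h - 1)%Z by case: ifP; lia.
move: (if _ then _ else _) even_l => l even_l.
split=> x y.
  have e : P (true, (x, y)) <-> ((2 %| top G y)%Z <-> (2 %| x)%Z).
    by have := alternate_parity (fun x => (aP x y).1) x; have := Gt y; tauto.
  have := walk_parity x wF; rewrite F0 => px.
  by split => [/e[]|?]; [|apply/e; split]; lia.
have e : P (false, (x, y)) <-> ((2 %| top F x)%Z <-> (2 %| y)%Z).
  by have := alternate_parity (fun y => (aP x y).2) y; have := Ft x; tauto.
have := walk_parity y wG; rewrite G0 => py.
by split => [/e[]|?]; [|apply/e; split]; lia.
Qed.

Lemma Z2_int x : x%:~R = (if (2 %| x)%Z then 0 else 1) :> 'Z_2.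
Proof.
elim/int_step_ind: x => // x.
have -> : x%:~R = (x - 1)%:~R + 1 :> 'Z_2 by rewrite rmorphB /= subrK.
have two : 1 + 1 = 0 :> 'Z_2 by apply/val_inj.
have [] := boolP (2 %| x)%Z; have [] := boolP (2 %| x - 1)%Z; move=> ? ?.
- by lia.
- by split=> [->|/eqP] //; rewrite addr_eq0 => /eqP ->; apply/val_inj.
- by split=> [->|/eqP]; rewrite ?add0r // -subr_eq0 addrK => /eqP.
- by lia.
Qed.

Lemma Z2_case (a : 'Z_2) : a = 0 \/ a = 1.
Proof. by case: a => [[|[|//]] ?]; [left | right]; apply/val_inj. Qed.

Lemma Z2_eq x (a : 'Z_2) :
  x%:~R = a <-> (2 %| x)%Z = (a == 0).
Proof.
rewrite Z2_int; have [->|->] := Z2_case a.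
- by case: ifP; rewrite ?eqxx; split.
- by case: ifP; split.
Qed.

Lemma label_pattern_alternating eps eta : alternating (label_pattern eps eta).
Proof.
move=> x y; rewrite /label_pattern /= !Z2_eq.
have ex : (2 %| x - 1)%Z = ~~ (2 %| x)%Z by lia.
have ey : (2 %| y - 1)%Z = ~~ (2 %| y)%Z by lia.
by rewrite ex ey; split; case: (2 %| _)%Z; case: (_ == _).
Qed.

Lemma alternating_labels P : alternating P ->
  exists eps eta, P = label_pattern eps eta.
Proof.
move=> aP; exists (fun y => if `[< P (true, (0, y)) >] then 0 else 1).
exists (fun x => if `[< P (false, (x, 0)) >] then 0 else 1).
have label_eq (A B : Prop) (d : bool) : (A <-> (B <-> d)) ->
    A <-> d = ((if `[< B >] then 0 else 1 : 'Z_2) == 0).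
  move=> AB; have ff : ~ is_true false by [].
  have tt : is_true true by [].
  by case: asboolP => /= hB; case: d AB; split; try tauto.
apply/seteqP; rewrite /label_pattern; split=> -[b [x y]].
  case: b => Pxy /=; rewrite Z2_eq -label_eq.
  - exact: Pxy.
  - exact: (alternate_parity (fun x => (aP x y).1) x).
  - exact: Pxy.
  - exact: (alternate_parity (fun y => (aP x y).2) y).
case: b => /=; rewrite Z2_eq -label_eq.
- by apply.
- exact: (alternate_parity (fun x => (aP x y).1) x).
- by apply.
- exact: (alternate_parity (fun y => (aP x y).2) y).
Qed.

Lemma encodes_labels eps eta F G l : encodes (label_pattern eps eta) F G l ->
  (forall y, eps y = if (2 %| F 0 + top G y - l)%Z then 0 else 1) /\
  (forall x, eta x = if (2 %| top F x + G 0 - l)%Z then 0 else 1).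
Proof.
have label (a : 'Z_2) (d : bool) : (0%:~R = a <-> d) -> a = if d then 0 else 1.
  have [->|->] := Z2_case a; case: d => -[h1 h2] //.
    by have := h1 erefl.
  by have := h2 isT.
move=> [eh ev]; split=> z; apply: label; [exact: (eh 0 z) | exact: (ev z 0)].
Qed.

(** * Topological components are combinatorial ones *)

Definition orbit_stitches P F G l v : set stitch :=
  [set s | P s /\ orbit F G l v (source s)].

Section StitchGraph.
Variables (P : set stitch) (F G : int -> int) (l : int).
Hypotheses (walkF : walk F) (walkG : walk G) (encP : encodes P F G l).

Lemma stable_stitch Q s : stable F G l Q -> P s -> Q (source s) <-> Q (target s).
Proof.
move: s => [[] [x y]] stQ; rewrite /target /source /=.
  move=> /encP.1 d; have e : hn F G l (x, y) = (x + 1, y) by rewrite /hn d.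
  rewrite -e; split=> [/stQ[]//|/stQ[+ _]]; by rewrite hnK.
move=> /encP.2 d; have e : vn F G l (x, y) = (x, y + 1).
  by rewrite /vn /hn /flipxy /= [G y + _]addrC d.
by rewrite -e; split=> [/stQ[]//|/stQ[_ +]]; rewrite vnK.
Qed.

Lemma hn_stitch v : exists s,
  [/\ P s, horizontal s, endpoint s v & endpoint s (hn F G l v)].
Proof.
case: v => x y; rewrite /hn /=; case: ifPn => d.
  by exists (true, (x, y)); split; [exact/encP.1 | | left | right].
exists (true, (x - 1, y)); split.
- by apply/encP.1; have := walkF x; lia.
- by [].
- by right; rewrite /target /= subrK.
- by left.
Qed.

Lemma vn_stitch v : exists s,
  [/\ P s, ~~ horizontal s, endpoint s v & endpoint s (vn F G l v)].
Proof.
case: v => x y; rewrite /vn /hn /flipxy /=; case: ifPn => d /=.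
  by exists (false, (x, y)); split; [apply/encP.2; lia | | left | right].
exists (false, (x, y - 1)); split.
- by apply/encP.2; have := walkG y; lia.
- by [].
- by right; rewrite /target /= subrK.
- by left.
Qed.

Lemma stable_endpoint Q s u : stable F G l Q -> P s -> endpoint s u ->
  Q u <-> Q (source s).
Proof. by move=> stQ Ps [] ->; rewrite // stable_stitch. Qed.

(** Two lattice segments whose bounding boxes meet share a lattice point which
    is an endpoint of both. *)
Lemma stable_touch Q s t : stable F G l Q -> P s -> P t ->
  ((source s).1 <= (target t).1 /\ (source t).1 <= (target s).1) /\
  ((source s).2 <= (target t).2 /\ (source t).2 <= (target s).2) ->
  Q (source s) -> Q (source t).
Proof.
move=> stQ Ps Pt touch Qs.
suff [u us ut] : exists2 u, endpoint s u & endpoint t u.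
  by apply/(stable_endpoint stQ Pt ut)/(stable_endpoint stQ Ps us).
move: s t touch {Ps Pt Qs} => [[] [x y]] [[] [a b]];
  rewrite /endpoint /source /target /= => -[[h1 h2] [h3 h4]].
- have -> : b = y by lia.
  have [->|[->|->]] : a = x \/ a = x + 1 \/ a = x - 1 by lia.
  + by exists (x, y); left.
  + by exists (x + 1, y); [right | left].
  + by exists (x, y); [left | right; rewrite subrK].
- exists (a, y).
  + by (have [->|->] : a = x \/ a = x + 1 by lia); [left | right].
  + by (have [->|->] : y = b \/ y = b + 1 by lia); [left | right].
- exists (x, b).
  + by (have [->|->] : b = y \/ b = y + 1 by lia); [left | right].
  + by (have [->|->] : x = a \/ x = a + 1 by lia); [left | right].
- have -> : a = x by lia.
  have [->|[->|->]] : b = y \/ b = y + 1 \/ b = y - 1 by lia.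
  + by exists (x, y); left.
  + by exists (x, y + 1); [right | left].
  + by exists (x, y); [left | right; rewrite subrK].
Qed.

End StitchGraph.

Section Topology.
Variable R : realType.

Definition point u : R * R := (u.1%:~R, u.2%:~R).

Lemma pair_continuous (T : topologicalType) (f g : T -> R) :
  continuous f -> continuous g -> continuous (fun a => (f a, g a) : R * R).
Proof. by move=> cf cg t; exact: (cvg_pair (cf t) (cg t)). Qed.

Lemma segment_endpoint s u : endpoint s u -> @segment R s (point u).
Proof.
move: s => [[] [x y]] [] ->; rewrite /segment /point /source /target /=;
by split; rewrite ?lexx ?ler_int; lia.
Qed.

Lemma connected_segment s : connected (@segment R s).
Proof.
move: s => [b [x y]].
have -> : @segment R (b, (x, y)) = (fun t : R =>
    ((x%:~R + (if b then t else 0), y%:~R + (if b then 0 else t)) : R * R)) @`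
      `[0, 1].
  apply/seteqP; split=> [[p q]|_ [t + <-]]; rewrite /segment /source /target /=.
    case: b => /=; rewrite ?intrD => -[h1 h2].
      by exists (p - x%:~R); rewrite /= ?in_itv /=; [lra | congr pair; lra].
    by exists (q - y%:~R); rewrite /= ?in_itv /=; [lra | congr pair; lra].
  by rewrite in_itv /=; case: b => /=; rewrite ?intrD; lra.
apply: connected_continuous_connected.
  by apply/connected_intervalP; exact: interval_is_interval.
apply: continuous_subspaceT; apply: pair_continuous => t.
  by apply: cvgD; [exact: cvg_cst | case: b; [exact: cvg_id | exact: cvg_cst]].
by apply: cvgD; [exact: cvg_cst | case: b; [exact: cvg_cst | exact: cvg_id]].
Qed.

(** Segments with integer coordinates that are at distance less than 1 in the
    sup norm have intersecting bounding boxes. *)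
Lemma segments_touch s t (p q : R * R) :
  @segment R s p -> @segment R t q -> ball p 1 q ->
  ((source s).1 <= (target t).1 /\ (source t).1 <= (target s).1) /\
  ((source s).2 <= (target t).2 /\ (source t).2 <= (target s).2).
Proof.
move=> [s1 s2] [t1 t2] [b1 b2].
have near (a b c d : int) (r r' : R) : a%:~R <= r <= b%:~R ->
    c%:~R <= r' <= d%:~R -> ball r 1 r' -> a <= d /\ c <= b.
  rewrite /ball /= => h1 h2; rewrite ltr_norml => h3.
  have : a%:~R < (d + 1)%:~R :> R by rewrite intrD; lra.
  have : c%:~R < (b + 1)%:~R :> R by rewrite intrD; lra.
  by rewrite !ltr_int; lia.
by split; [exact: near s1 t1 b1 | exact: near s2 t2 b2].
Qed.

(** The union of the stitches of an orbit is connected since each stitch is, and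
    it is relatively open and closed in the union of the pattern, because a
    stitch of another orbit is at distance at least 1. *)
Lemma component_orbit P F G l s0 (x0 : R * R) : walk F -> walk G ->
  encodes P F G l -> P s0 -> @segment R s0 x0 ->
  connected_component (@stitch_union R P) x0 =
  @stitch_union R (orbit_stitches P F G l (source s0)).
Proof.
move=> wF wG enc Ps0 x0s0.
set O := orbit_stitches _ _ _ _ _; set U := @stitch_union R P.
set K := connected_component U x0.
have stO := @orbit_stable F G l (source s0).
have Os0 : O s0 by split=> // Q.
have seg_in s : P s -> (exists2 p, @segment R s p & K p) -> @segment R s `<=` K.
  move=> Ps [p sp Kp] q sq; apply: connected_component_trans Kp _.
  apply: (connected_component_max sp) sq; last exact: connected_segment.
  by move=> r sr; exists s.
apply/seteqP; split.
  have near (p q : R * R) : U p -> (exists2 r, O r & @segment R r q) ->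
    ball q 1 p ->
      @stitch_union R O p.
    move=> [t Pt tp] [r [Pr Or] rq] bqp; exists t => //; split=> //.
    exact: (stable_touch wF wG enc stO Pr Pt (segments_touch rq tp bqp) Or).
  have <- : K `&` @stitch_union R O = K.
    apply: component_connected.
    - by exists x0; split; [apply: connected_component_refl; exists s0 | exists s0].
    - exists (\bigcup_(q in @stitch_union R O) ball q 1).
        by apply: bigcup_open => q _; exact: ball_open.
      apply/seteqP; split=> p [Kp].
        by move=> Op; split=> //; exists p => //; exact: ballxx.
      move=> [q [r Or rq] bqp]; split=> //.
      by apply: near bqp; [exact: connected_component_sub Kp | exists r].
    - exists (~` \bigcup_(q in U `\` @stitch_union R O) ball q 1).
        by apply: open_closedC; apply: bigcup_open => q _; exact: ball_open.
      apply/seteqP; split=> p [Kp].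
        move=> [r Or rp]; split=> // -[q [Uq nOq] bqp]; apply: nOq.
        by apply: near Uq _ (ball_sym bqp); exists r.
      move=> nC; split=> //; apply: contrapT => nO; apply: nC; exists p.
        by split=> //; exact: connected_component_sub Kp.
      exact: ballxx.
  by move=> p [].
have vertexK u : orbit F G l (source s0) u -> K (point u).
  move=> /(_ (fun u => K (point u))); apply => [v Kv|].
    have [h [Ph _ hv hh]] := hn_stitch wF enc v.
    have [t [Pt _ tv tt]] := vn_stitch wG enc v.
    by split; [apply: (seg_in h) | apply: (seg_in t)] => //;
      try exact: segment_endpoint; exists (point v) => //; exact: segment_endpoint.
  apply: (seg_in s0) => //; last by apply: segment_endpoint; left.
  by exists x0 => //; apply: connected_component_refl; exists s0.
move=> p [s [Ps Os] sp]; apply: (seg_in s) => //.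
by exists (point (source s)); [apply: segment_endpoint; left | exact: vertexK].
Qed.

(** The midpoint of a stitch lies on no other stitch. *)
Lemma segment_sub_union (O : set stitch) s :
  @segment R s `<=` @stitch_union R O -> O s.
Proof.
move: s => [b [x y]] sub.
have [|t Ot] := sub (x%:~R + (if b then 2^-1 else 0),
  y%:~R + (if b then 0 else 2^-1)).
  by rewrite /segment /source /target /=; case: b {sub} => /=; rewrite ?intrD; lra.
have le_half (a c : int) : a%:~R <= c%:~R + 2^-1 :> R -> a <= c.
  by move=> h; rewrite -ltzD1 -(ltr_int R) intrD; lra.
have half_le (a c : int) : c%:~R + 2^-1 <= a%:~R :> R -> c + 1 <= a.
  by move=> h; rewrite lezD1 -(ltr_int R); lra.
rewrite /segment /source /target; move: t Ot => [[] [a c]] Oac /=;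
  case: b {sub} => /= -[/andP[h1 h2] /andP[h3 h4]].
- move: h3 h4; rewrite addr0 !ler_int => h3 h4.
  have := le_half _ _ h1; have := half_le _ _ h2 => ? ?.
  have ea : a = x by lia.
  have ec : c = y by lia.
  by rewrite -ea -ec.
- have := le_half _ _ h3; have := half_le _ _ h4; lia.
- have := le_half _ _ h1; have := half_le _ _ h2; lia.
- move: h1 h2; rewrite addr0 !ler_int => h1 h2.
  have := le_half _ _ h3; have := half_le _ _ h4 => ? ?.
  have ea : a = x by lia.
  have ec : c = y by lia.
  by rewrite -ea -ec.
Qed.

Lemma stitches_union (O : set stitch) : stitches (@stitch_union R O) = O.
Proof.
by apply/seteqP; split=> s; [exact: segment_sub_union | move=> Os p sp; exists s].
Qed.

Lemma bounded_vertices (L : set (R * R)) : bounded_set L ->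
  exists N : int, forall u, L (point u) -> `|u.1| <= N /\ `|u.2| <= N.
Proof.
move=> [M [_ bM]]; exists (Num.ceil (M + 1)) => u /(bM (M + 1)).
rewrite ltrDl ltr01 => /(_ isT); rewrite /= prod_normE ge_max => /andP[].
by rewrite /= -!intr_norm => h1 h2; split; rewrite -(ler_int R);
  [apply: le_trans h1 _ | apply: le_trans h2 _]; exact: Num.Theory.ceil_ge.
Qed.

Lemma loop_orbit P L : alternating P -> loop_of P L -> exists v F G l,
  [/\ walk F, walk G, encodes P F G l, level F G l v &
      L = @stitch_union R (orbit_stitches P F G l v) /\
      exists N : int, forall u, orbit F G l v u -> `|u.1| <= N /\ `|u.2| <= N].
Proof.
move=> aP [[x [s0 Ps0 s0x] eL] bL].
have [F [G [l [wF wG enc lev]]]] := alternating_heights (source s0) aP.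
exists (source s0), F, G, l; split=> //.
have eL' := component_orbit wF wG enc Ps0 s0x; rewrite -eL in eL'.
split=> //; have [N NP] := bounded_vertices bL; exists N => u ou; apply: NP.
have [h [Ph _ hu hh]] := hn_stitch wF enc u.
rewrite eL'; exists h; last exact: segment_endpoint.
by split=> //; apply/(stable_endpoint wF wG enc (@orbit_stable F G l _) Ph hu).
Qed.

End Topology.

(** * Bounding box, width and height *)

Lemma int_max (A : int -> Prop) N a : A a -> (forall b, A b -> b <= N) ->
  exists2 m, A m & forall b, A b -> b <= m.
Proof.
move=> Aa AN; have [n] : exists n : nat, N - a <= n%:Z.
  by exists (absz (N - a)%R); lia.
elim: n a Aa => [|n IHn] a Aa le_n.
  by exists a => // b /AN; lia.
have [[b Ab lt_ab]|no_b] := pselect (exists2 b, A b & a < b).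
  by apply: (IHn b) => //; lia.
by exists a => // b Ab; rewrite leNgt; apply/negP => lt_ab; apply: no_b; exists b.
Qed.

Lemma bbox_exists S u N : S u ->
  (forall w, S w -> `|w.1| <= N /\ `|w.2| <= N) ->
  exists x0 x1 y0 y1, bbox S x0 x1 y0 y1.
Proof.
move=> Su SN.
have ext (f : int * int -> int) : (forall w, S w -> `|f w| <= N) ->
    exists2 m, (exists2 w, S w & f w = m) & forall w, S w -> f w <= m.
  move=> fN; have [||m [w Sw fw] mP] :=
    @int_max (fun m => exists2 w, S w & f w = m) N (f u).
  - by exists u.
  - by move=> _ [w /fN Sw <-]; lia.
  - by exists m; [exists w | move=> w' Sw'; apply: mP; exists w'].
have [x1 [[a ?] Sx1 /= ea] x1P] := ext fst (fun w Sw => (SN w Sw).1).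
have [y1 [[? b] Sy1 /= eb] y1P] := ext snd (fun w Sw => (SN w Sw).2).
have [|x0 [[c ?] Sx0 /= ec] x0P] := ext (fun w => - w.1).
  by move=> w /SN[]; rewrite normrN.
have [|y0 [[? d] Sy0 /= ed] y0P] := ext (fun w => - w.2).
  by move=> w /SN[]; rewrite normrN.
exists (- x0), x1, (- y0), y1; split.
- move=> w Sw; have := x0P w Sw; have := x1P w Sw; have := y0P w Sw.
  by have := y1P w Sw; lia.
- by eexists; rewrite -ec opprK; exact: Sx0.
- by eexists; rewrite -ea; exact: Sx1.
- by eexists; rewrite -ed opprK; exact: Sy0.
- by eexists; rewrite -eb; exact: Sy1.
Qed.

Section Extent.
Variable R : realType.
Implicit Types L : set (R * R).

Lemma is_maximum_uniq (A : set R) (a b : R) :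
  is_maximum A a -> is_maximum A b -> a = b.
Proof.
by move=> [Aa ua] [Ab ub]; apply/eqP; rewrite eq_le ua //= andbT; apply: ub.
Qed.

Lemma has_width_uniq L w w' : has_width L w -> has_width L w' -> w = w'.
Proof. by move=> h h'; apply/eqP; rewrite -(eqr_nat R) (is_maximum_uniq h h'). Qed.

Lemma has_height_uniq L w w' : has_height L w -> has_height L w' -> w = w'.
Proof. by move=> h h'; apply/eqP; rewrite -(eqr_nat R) (is_maximum_uniq h h'). Qed.

Lemma orbit_stitch_ends P F G l v s u : walk F -> walk G -> encodes P F G l ->
  P s -> endpoint s u -> orbit F G l v u <-> orbit_stitches P F G l v s.
Proof.
move=> wF wG enc Ps su.
rewrite (stable_endpoint wF wG enc (@orbit_stable F G l v) Ps su).
by split=> [|[]].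
Qed.

Section Orbit.
Variables (P : set stitch) (F G : int -> int) (l : int) (v : int * int).
Variables (x0 x1 y0 y1 : int) (L : set (R * R)).
Hypotheses (walkF : walk F) (walkG : walk G) (encP : encodes P F G l).
Hypothesis bS : bbox (orbit F G l v) x0 x1 y0 y1.
Hypothesis LE : L = stitch_union (orbit_stitches P F G l v).

Lemma orbit_bounds s : orbit_stitches P F G l v s ->
  (x0 <= (source s).1 <= x1 /\ x0 <= (target s).1 <= x1) /\
  (y0 <= (source s).2 <= y1 /\ y0 <= (target s).2 <= y1).
Proof.
move=> Os; case: bS => b _ _ _ _; have [Ps os] := Os.
have /b[] := os; suff /b[] : orbit F G l v (target s) by [].
by apply/(orbit_stitch_ends _ walkF walkG encP Ps) => //; right.
Qed.

(** Every point of the orbit is on a vertical stitch, whose longitude is the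
    abscissa of the point; so the extreme longitudes are [x0] and [x1]. *)
Lemma maximum_longitude : is_maximum
  [set longitude R s - longitude R t | s in stitches L
    & t in stitches L] (x1 - x0)%:~R.
Proof.
rewrite LE stitches_union; case: bS => b [yl Sl] [yr Sr] _ _.
have at_line x y : orbit F G l v (x, y) ->
    exists2 s, orbit_stitches P F G l v s & longitude R s = x%:~R.
  move=> o; have [s [Ps hs vs _]] := vn_stitch walkG encP (x, y).
  exists s; first exact/(orbit_stitch_ends _ walkF walkG encP Ps vs).
  move: s hs vs {Ps} => [[] [a c]] // _; rewrite /longitude /source /target /=.
  by case=> -[-> _]; lra.
split.
  have [s Os es] := at_line _ _ Sr; have [t Ot et] := at_line _ _ Sl.
  by exists s => //; exists t => //; rewrite es et intrB.
move=> _ [s /orbit_bounds[[/andP[_ s1] /andP[_ s2]] _]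
  [t /orbit_bounds[[/andP[t1 _] /andP[t2 _]] _] <-]].
rewrite /longitude intrB; move: s1 s2 t1 t2; rewrite -!(ler_int R); lra.
Qed.

Lemma maximum_latitude : is_maximum
  [set latitude R s - latitude R t | s in stitches L
    & t in stitches L] (y1 - y0)%:~R.
Proof.
rewrite LE stitches_union; case: bS => b _ _ [xl Sl] [xr Sr].
have at_line x y : orbit F G l v (x, y) ->
    exists2 s, orbit_stitches P F G l v s & latitude R s = y%:~R.
  move=> o; have [s [Ps hs vs _]] := hn_stitch walkF encP (x, y).
  exists s; first exact/(orbit_stitch_ends _ walkF walkG encP Ps vs).
  move: s hs vs {Ps} => [[] [a c]] // _; rewrite /latitude /source /target /=.
  by case=> -[_ ->]; lra.
split.
  have [s Os es] := at_line _ _ Sr; have [t Ot et] := at_line _ _ Sl.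
  by exists s => //; exists t => //; rewrite es et intrB.
move=> _ [s /orbit_bounds[_ [/andP[_ s1] /andP[_ s2]]]
  [t /orbit_bounds[_ [/andP[t1 _] /andP[t2 _]]] <-]].
rewrite /latitude intrB; move: s1 s2 t1 t2; rewrite -!(ler_int R); lra.
Qed.

Lemma width_bbox w : has_width L w -> x1 - x0 = w%:Z.
Proof.
move=> /is_maximum_uniq /(_ maximum_longitude) e; apply/eqP.
by rewrite -(eqr_int R) -e.
Qed.

Lemma height_bbox h : has_height L h -> y1 - y0 = h%:Z.
Proof.
move=> /is_maximum_uniq /(_ maximum_latitude) e; apply/eqP.
by rewrite -(eqr_int R) -e.
Qed.

Lemma point_orbit u : orbit F G l v u -> L (point R u).
Proof.
move=> o; have [s [Ps _ su _]] := hn_stitch walkF encP u.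
by rewrite LE; exists s; [apply/(orbit_stitch_ends _ walkF walkG encP Ps su)
  | exact: segment_endpoint].
Qed.

End Orbit.
End Extent.

(** * Translations and rotations *)

Section Motion.
Variable R : realType.
Implicit Types L : set (R * R).
Variables (f g : R * R -> R * R) (phi psi : stitch -> stitch).
Hypotheses (fK : cancel f g) (gK : cancel g f).
Hypotheses (phiK : cancel phi psi) (psiK : cancel psi phi).
Hypotheses (cf : continuous f) (cg : continuous g).
Hypothesis seg : forall s, segment (phi s) = f @` segment s.

Lemma stitches_motion L : stitches (f @` L) = phi @` stitches L.
Proof.
apply/seteqP; split=> [s|_ [s Ls <-]].
  rewrite -{1}(psiK s) /stitches /= seg => sub; exists (psi s) => //.
  move=> p sp; have [|q Lq e] := sub (f p); first by exists p.
  by rewrite -(fK p) -e fK.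
by rewrite /stitches /= seg; exact: image_subset.
Qed.

Lemma loop_length_motion L : finite_set (stitches L) ->
  loop_length (f @` L) = loop_length L.
Proof.
move=> fin; rewrite /loop_length stitches_motion.
apply/fcard_eq => //; first exact: finite_image.
by apply: inj_card_eq; apply: in2W; exact: can_inj phiK.
Qed.

Lemma stitch_union_motion P : stitch_union (phi @` P) = f @` stitch_union P.
Proof.
apply/seteqP; split=> [p [_ [s Ps <-]]|_ [p [s Ps sp] <-]].
  by rewrite seg => -[q sq <-]; exists q => //; exists s.
by exists (phi s); [exists s | rewrite seg; exists p].
Qed.

Lemma connected_component_motion (U : set (R * R)) (x : R * R) :
  connected_component (f @` U) (f x) = f @` connected_component U x.
Proof.
apply/seteqP; split=> [p [C [Cx CU cC] Cp]|_ [p [C [Cx CU cC] Cp] <-]].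
  exists (g p) => //; exists (g @` C); last by exists p.
  split; first by exists (f x).
    by move=> _ [q /CU[r Ur <-] <-]; rewrite fK.
  by apply: connected_continuous_connected => //; exact: continuous_subspaceT.
exists (f @` C); last by exists p.
split; first by exists x.
  exact: image_subset.
by apply: connected_continuous_connected => //; exact: continuous_subspaceT.
Qed.

Lemma loop_of_motion P L : (bounded_set L -> bounded_set (f @` L)) ->
  loop_of P L -> loop_of (phi @` P) (f @` L).
Proof.
move=> bf [[x Ux e] bL]; split; last exact: bf.
exists (f x); first by rewrite stitch_union_motion; exists x.
by rewrite stitch_union_motion connected_component_motion e.
Qed.

End Motion.

Section Translation.
Variable R : realType.
Implicit Types L : set (R * R).

Definition shift_stitch v s : stitch := (s.1, (s.2.1 + v.1, s.2.2 + v.2)).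

Definition opp_vec v : int * int := (- v.1, - v.2).

Lemma shift_stitchK v : cancel (shift_stitch v) (shift_stitch (opp_vec v)).
Proof. by case=> b [x y]; rewrite /shift_stitch /= !addrK. Qed.

Lemma shift_stitchNK v : cancel (shift_stitch (opp_vec v)) (shift_stitch v).
Proof. by case=> b [x y]; rewrite /shift_stitch /= !subrK. Qed.

Definition shift_point v (p : R * R) : R * R := (p.1 + v.1%:~R, p.2 + v.2%:~R).

Lemma shift_pointK v : cancel (shift_point v) (shift_point (opp_vec v)).
Proof. by case=> p q; rewrite /shift_point /= !intrN !addrK. Qed.

Lemma shift_pointNK v : cancel (shift_point (opp_vec v)) (shift_point v).
Proof. by case=> p q; rewrite /shift_point /= !intrN !subrK. Qed.

Lemma translateE v L : translate v L = shift_point v @` L.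
Proof. by []. Qed.

Lemma translateK v L : translate v (translate (opp_vec v) L) = L.
Proof.
rewrite !translateE image_comp (_ : _ \o _ = id) ?image_id //.
by apply/funext => p; exact: shift_pointNK.
Qed.

Lemma shift_point_continuous v : continuous (shift_point v).
Proof.
apply: pair_continuous => p.
  by apply: cvgD; [exact: cvg_fst | exact: cvg_cst].
by apply: cvgD; [exact: cvg_snd | exact: cvg_cst].
Qed.

Lemma segment_shift v s :
  segment (shift_stitch v s) = shift_point v @` (segment s : set (R * R)).
Proof.
apply/seteqP; split=> [[p q]|_ [[p q] + <-]];
  case: s => b [x y]; rewrite /segment /target /source /=.
  move=> pq; exists (p - v.1%:~R, q - v.2%:~R);
    last by rewrite /shift_point /= !subrK.
  by move: pq; case: b => /=; rewrite !intrD /=; lra.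
by case: b => /=; rewrite !intrD; lra.
Qed.

Lemma bounded_setW L L' (c : R) :
  (forall p : R * R, L' p -> exists2 q : R * R, L q & `|p| <= `|q| + c) ->
  bounded_set L -> bounded_set L'.
Proof.
move=> LL' [M [Mr bM]]; exists (M + 1 + c); split; first exact: num_real.
move=> N ltN p /LL'[q Lq le_pq]; have := bM (M + 1) _ q Lq.
by rewrite ltrDl ltr01 => /(_ isT) /=; lra.
Qed.

Lemma bounded_translate v L : bounded_set L -> bounded_set (translate v L).
Proof.
apply: (@bounded_setW _ _ `|point R v|) => _ [p Lp <-]; exists p => //.
exact: (ler_normD p (point R v)).
Qed.

Lemma loop_of_translate v P L : loop_of P L ->
  loop_of (shift_stitch v @` P) (translate v L).
Proof.
rewrite translateE; apply: loop_of_motion.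
- exact: shift_pointK.
- exact: shift_pointNK.
- exact: shift_point_continuous.
- exact: shift_point_continuous.
- exact: segment_shift.
- exact: bounded_translate.
Qed.

Lemma shift_stitchE v P s : (shift_stitch v @` P) s <->
  P (shift_stitch (opp_vec v) s).
Proof.
split=> [[t Pt <-]|Ps]; first by rewrite shift_stitchK.
by exists (shift_stitch (opp_vec v) s) => //; rewrite shift_stitchNK.
Qed.

Lemma alternating_translate v P : alternating P ->
  alternating (shift_stitch v @` P).
Proof.
move=> aP x y; rewrite !shift_stitchE /shift_stitch /=.
by rewrite [x - 1 + _]addrAC [y - 1 + _]addrAC; exact: aP.
Qed.

Lemma loop_length_translate v L : finite_set (stitches L) ->
  loop_length (translate v L) = loop_length L.
Proof.
rewrite translateE; apply: loop_length_motion.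
- exact: shift_pointK.
- exact: shift_stitchK.
- exact: shift_stitchNK.
- exact: segment_shift.
Qed.

Lemma stitches_translate v L :
  stitches (translate v L) = shift_stitch v @` stitches L.
Proof.
rewrite translateE; apply: stitches_motion.
- exact: shift_pointK.
- exact: shift_stitchNK.
- exact: segment_shift.
Qed.

Lemma differences_motion (phi : stitch -> stitch) (a b : stitch ->
  R) (c : R) (X : set stitch) :
  (forall s, a (phi s) = b s + c) ->
  [set a s - a t | s in phi @` X & t in phi @` X] = [set b s - b t | s in X
    & t in X].
Proof.
move=> ab; apply/seteqP; split=>
  [_ [_ [s Xs <-] [_ [t Xt <-] <-]]|_ [s Xs [t Xt <-]]].
  by exists s => //; exists t => //; rewrite !ab; lra.
by exists (phi s); [exists s | exists (phi t); [exists t | rewrite !ab; lra]].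
Qed.

Lemma has_width_translate v L w : has_width L w -> has_width (translate v L) w.
Proof.
rewrite /has_width stitches_translate
  (@differences_motion _ _ (longitude R) v.1%:~R) //.
by move=> [[] [x y]]; rewrite /longitude /target /source /= !intrD; lra.
Qed.

Lemma has_height_translate v L w : has_height L w -> has_height (translate v L) w.
Proof.
rewrite /has_height stitches_translate
  (@differences_motion _ _ (latitude R) v.2%:~R) //.
by move=> [[] [x y]]; rewrite /latitude /target /source /= !intrD; lra.
Qed.

End Translation.

Section Rotation.
Variable R : realType.
Implicit Types L : set (R * R).

Definition rot_stitch s : stitch :=
  if s.1 then (false, (- s.2.2, s.2.1)) else (true, (- s.2.2 - 1, s.2.1)).

Definition unrot_stitch s : stitch :=
  if s.1 then (false, (s.2.2, - s.2.1 - 1)) else (true, (s.2.2, - s.2.1)).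

Lemma rot_stitchK : cancel rot_stitch unrot_stitch.
Proof. by case=> [[] [x y]]; rewrite /rot_stitch /unrot_stitch /=;
  do !congr pair; lia. Qed.

Lemma unrot_stitchK : cancel unrot_stitch rot_stitch.
Proof. by case=> [[] [x y]]; rewrite /rot_stitch /unrot_stitch /=;
  do !congr pair; lia. Qed.

Definition rot_point (p : R * R) : R * R := (- p.2, p.1).
Definition unrot_point (p : R * R) : R * R := (p.2, - p.1).

Lemma rot_pointK : cancel rot_point unrot_point.
Proof. by case=> p q; rewrite /rot_point /unrot_point /= opprK. Qed.

Lemma unrot_pointK : cancel unrot_point rot_point.
Proof. by case=> p q; rewrite /rot_point /unrot_point /= opprK. Qed.

Lemma rotate90E L : rotate90 L = rot_point @` L.
Proof. by []. Qed.

Lemma rot_continuous : continuous rot_point.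
Proof.
by apply: pair_continuous => p; [apply: cvgN; exact: cvg_snd | exact: cvg_fst].
Qed.

Lemma unrot_continuous : continuous unrot_point.
Proof.
by apply: pair_continuous => p; [exact: cvg_snd | apply: cvgN; exact: cvg_fst].
Qed.

Lemma segment_rot s : segment (rot_stitch s) = rot_point @` (segment s :
  set (R * R)).
Proof.
apply/seteqP; split=> [[p q]|_ [[p q] + <-]];
  case: s => [[] [x y]]; rewrite /segment /target /source /=.
- move=> pq; exists (q, - p); last by rewrite /rot_point /= opprK.
  by move: pq; rewrite /= ?(intrD, intrN); lra.
- move=> pq; exists (q, - p); last by rewrite /rot_point /= opprK.
  by move: pq; rewrite /= ?(intrD, intrN); lra.
- by rewrite ?(intrD, intrN); lra.
- by rewrite ?(intrD, intrN); lra.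
Qed.

Lemma segment_unrot s : segment (unrot_stitch s) = unrot_point @` (segment s :
  set (R * R)).
Proof.
rewrite -{2}(unrot_stitchK s) segment_rot image_comp.
rewrite (_ : _ \o _ = id) ?image_id //; apply/funext => p; exact: rot_pointK.
Qed.

Lemma bounded_unrot L : bounded_set L -> bounded_set (unrot_point @` L).
Proof.
apply: (@bounded_setW _ _ _ 0) => _ [p Lp <-]; exists p => //.
by rewrite addr0 !prod_normE /= normrN maxC.
Qed.

Lemma loop_of_unrot P L : loop_of P L ->
  loop_of (unrot_stitch @` P) (unrot_point @` L).
Proof.
apply: loop_of_motion.
- exact: unrot_pointK.
- exact: rot_pointK.
- exact: unrot_continuous.
- exact: rot_continuous.
- exact: segment_unrot.
- exact: bounded_unrot.
Qed.

Lemma unrot_stitchE P s : (unrot_stitch @` P) s <-> P (rot_stitch s).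
Proof.
split=> [[t Pt <-]|Ps]; first by rewrite unrot_stitchK.
by exists (rot_stitch s) => //; rewrite rot_stitchK.
Qed.

Lemma alternating_unrot P : alternating P -> alternating (unrot_stitch @` P).
Proof.
move=> aP x y; rewrite !unrot_stitchE /rot_stitch /=.
have [_ a1] := aP (- y) x; have [a2 _] := aP (- y) x.
split; first by have [_ +] := aP (- y) x.
have -> : - (y - 1) - 1 = - y by lia.
by split=> [h1 /a2/(_ h1) //|h]; apply: contrapT => nh; apply: h; apply/a2.
Qed.

Lemma stitches_rot L : stitches (rotate90 L) = rot_stitch @` stitches L.
Proof.
rewrite rotate90E; apply: stitches_motion.
- exact: rot_pointK.
- exact: unrot_stitchK.
- exact: segment_rot.
Qed.

Lemma stitches_unrot L : stitches (unrot_point @` L) = unrot_stitch @` stitches L.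
Proof.
apply: stitches_motion.
- exact: unrot_pointK.
- exact: rot_stitchK.
- exact: segment_unrot.
Qed.

Lemma loop_length_rot L : finite_set (stitches L) ->
  loop_length (rotate90 L) = loop_length L.
Proof.
rewrite rotate90E; apply: loop_length_motion.
- exact: rot_pointK.
- exact: rot_stitchK.
- exact: unrot_stitchK.
- exact: segment_rot.
Qed.

Lemma differences_anti (phi : stitch -> stitch) (a b : stitch ->
  R) (X : set stitch) :
  (forall s, a (phi s) = - b s) ->
  [set a s - a t | s in phi @` X & t in phi @` X] = [set b s - b t | s in X
    & t in X].
Proof.
move=> ab; apply/seteqP; split=>
  [_ [_ [s Xs <-] [_ [t Xt <-] <-]]|_ [s Xs [t Xt <-]]].
  by exists t => //; exists s => //; rewrite !ab; lra.
by exists (phi t); [exists t | exists (phi s); [exists s | rewrite !ab; lra]].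
Qed.

Lemma has_width_rot L w : has_height L w -> has_width (rotate90 L) w.
Proof.
rewrite /has_width stitches_rot (@differences_anti _ _ (latitude R)) //.
by move=> [[] [x y]]; rewrite /longitude /latitude /target /source /= ?(intrD,
  intrN); lra.
Qed.

Lemma has_height_rot L w : has_width L w -> has_height (rotate90 L) w.
Proof.
rewrite /has_height stitches_rot (@differences_motion _ _ _ (longitude R) 0) //.
by move=> [[] [x y]]; rewrite /longitude /latitude /target /source /= ?(intrD,
  intrN); lra.
Qed.

Lemma has_width_unrot L w : has_height L w -> has_width (unrot_point @` L) w.
Proof.
rewrite /has_width stitches_unrot (@differences_motion _ _ _ (latitude R) 0) //.
by move=> [[] [x y]]; rewrite /longitude /latitude /target /source /= ?(intrD,
  intrN); lra.
Qed.

Lemma has_height_unrot L w : has_width L w -> has_height (unrot_point @` L) w.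
Proof.
rewrite /has_height stitches_unrot (@differences_anti _ _ (longitude R)) //.
by move=> [[] [x y]]; rewrite /longitude /latitude /target /source /= ?(intrD,
  intrN); lra.
Qed.

End Rotation.

(** * Normalized heights and the length *)

Definition normal P (w h : int) F G n v : Prop :=
  [/\ walk F /\ walk G, encodes P F G n, level F G n v,
      bbox (orbit F G n v) 0 w 0 h &
      [/\ mound F G n 0 w 0 h, F 0 = 0 & G 0 = 0]].

(** The stitches at a point are determined by the pattern, whatever heights are
    used to describe it. *)
Lemma encodes_orbit P F G l F' G' l' v : walk F -> walk G ->
  encodes P F G l -> encodes P F' G' l' -> orbit F' G' l' v = orbit F G l v.
Proof.
move=> wF wG [eh ev] [eh' ev'].
have hnE u : hn F' G' l' u = hn F G l u.
  case: u => x y; rewrite /hn /=; congr (if _ then _ else _).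
  by apply/idP/idP => [/eh'/eh|/eh/eh'].
have vnE u : vn F' G' l' u = vn F G l u.
  case: u => x y; rewrite /vn /hn /= !(addrC _ (top _ x)).
  have -> : (2 %| top F' x + G' y - l')%Z = (2 %| top F x + G y - l)%Z.
    by apply/idP/idP => [/ev'/ev|/ev/ev'].
  by [].
have stE Q : stable F' G' l' Q <-> stable F G l Q.
  by split=> st u /st; rewrite hnE vnE.
by apply/funext => u; apply/propext; split=> o Q /stE; exact: o.
Qed.

Definition lower F k x : int := F x - k.

Lemma top_lower F k x : top (lower F k) x = top F x - k.
Proof. by rewrite /top /lower; lia. Qed.

Lemma normalize P F G l v w h : walk F -> walk G -> encodes P F G l ->
  level F G l v -> bbox (orbit F G l v) 0 w 0 h -> mound F G l 0 w 0 h ->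
  let n := l - F 0 - G 0 in
  normal P w h (lower F (F 0)) (lower G (G 0)) n v.
Proof.
move=> wF wG enc lev bS mnd n;
  have encn : encodes P (lower F (F 0)) (lower G (G 0)) n.
  case: enc => eh ev; split=> x y; rewrite top_lower /lower.
    by rewrite (_ : _ - n = F x + top G y - l) //; rewrite /n; lia.
  by rewrite (_ : _ - n = top F x + G y - l) //; rewrite /n; lia.
split=> //.
- by split=> x; [have := wF x | have := wG x]; rewrite /lower; lia.
- by move: lev; rewrite /level !top_lower /n; lia.
- by rewrite (encodes_orbit _ wF wG enc encn).
split; rewrite /lower ?subrr //.
case: mnd => -[a1 a2 a3 a4] [b1 b2 b3 b4] [c1 [j j_in c2]] [d1 [i i_in d2]].
split.
- by split; [lia | move=> x /a2; lia | lia | lia].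
- by split; [lia | move=> x /b2; lia | lia | lia].
- by split; [move=> x /c1; lia | exists j => //; lia].
- by split; [move=> x /d1; lia | exists i => //; lia].
Qed.

Lemma encodes_flip P F G l : walk F -> walk G -> encodes P F G l ->
  encodes P (flip F) (flip1 G) (- l).
Proof.
move=> wF wG [eh ev]; split=> x y.
  rewrite top_flip1 // /flip; split=> [/eh|d]; first by lia.
  by apply/eh; lia.
rewrite top_flip // /flip1; split=> [/ev|d]; first by lia.
by apply/ev; lia.
Qed.

Lemma level_flip F G l v : walk F -> walk G -> level F G l v ->
  level (flip F) (flip1 G) (- l) v.
Proof. by move=> wF wG; rewrite /level top_flip // top_flip1 //; lia. Qed.

Lemma loop_normal (R : realType) P (L : set (R * R)) (w h : nat) :
  alternating P -> loop_of P L -> L `<=` @region R w h ->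
  has_width L w -> has_height L h ->
  exists F G n v, normal P w%:Z h%:Z F G n v /\
    L = stitch_union (orbit_stitches P F G n v).
Proof.
move=> aP loopL Lreg Lw Lh.
have [v [F [G [l [wF wG enc lev [LE [N bN]]]]]]] := loop_orbit aP loopL.
have [x0 [x1 [y0 [y1 bS]]]] := bbox_exists (fun Q stQ (Qv : Q v) => Qv) bN.
have ew := width_bbox wF wG enc bS LE Lw.
have eh := height_bbox wF wG enc bS LE Lh.
have inreg u : orbit F G l v u -> (0 <= u.1 <= w%:Z) /\ (0 <= u.2 <= h%:Z).
  move=> /(point_orbit wF wG enc LE) /Lreg [/= r1 r2].
  by move: r1 r2; rewrite -!(ler_int R) //; lra.
have [ex0 ey0] : x0 = 0 /\ y0 = 0.
  case: (bS) => b [a /inreg/= ?] [c /inreg/= ?] [d /inreg/= ?] [e /inreg/= ?]; lia.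
subst x0 y0; rewrite !subr0 in ew eh; subst x1 y1.
have [mnd|mnd] := component_mound wF wG (orbit_component wF wG lev) bS.
  have nm := normalize wF wG enc lev bS mnd.
  do 4 eexists; split; first exact: nm.
  by case: nm => _ encn _ _ _; rewrite /orbit_stitches
    (encodes_orbit _ wF wG enc encn).
have enc' := encodes_flip wF wG enc.
have bS' : bbox (orbit (flip F) (flip1 G) (- l) v) 0 w 0 h.
  by rewrite (encodes_orbit _ wF wG enc enc').
have nm := normalize (walk_flip wF) (walk_flip1 wG) enc' (level_flip wF wG lev)
  bS' mnd.
do 4 eexists; split; first exact: nm.
by case: nm => _ encn _ _ _; rewrite /orbit_stitches
  (encodes_orbit _ wF wG enc encn).
Qed.

(** A bijection from lattice points to stitches: black points of the
    checkerboard are sent to their horizontal stitch and white points to their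
    vertical one.  Each stitch has exactly one endpoint of each colour. *)
Definition vertex_stitch F G l u : stitch :=
  if (2 %| u.1 + u.2)%Z then
    (true, if (2 %| F u.1 + top G u.2 - l)%Z then u else (u.1 - 1, u.2))
  else (false, if (2 %| top F u.1 + G u.2 - l)%Z then u else (u.1, u.2 - 1)).

Definition stitch_vertex s : int * int :=
  if s.1 then (if (2 %| s.2.1 + s.2.2)%Z then s.2 else (s.2.1 + 1, s.2.2))
  else (if (2 %| s.2.1 + s.2.2)%Z then (s.2.1, s.2.2 + 1) else s.2).

Lemma vertex_stitchK F G l : cancel (vertex_stitch F G l) stitch_vertex.
Proof.
case=> x y; rewrite /vertex_stitch /=; have [d|d] := boolP (2 %| x + y)%Z.
  case: ifP => _; rewrite /stitch_vertex /=; first by rewrite d.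
  by case: ifP => d'; rewrite ?subrK //; exfalso; lia.
case: ifP => _; rewrite /stitch_vertex /=; first by rewrite (negbTE d).
by case: ifP => d'; rewrite ?subrK //; exfalso; lia.
Qed.

Lemma stitch_vertexK P F G l s : walk F -> walk G -> encodes P F G l -> P s ->
  vertex_stitch F G l (stitch_vertex s) = s.
Proof.
move=> wF wG [eh ev]; move: s => [[] [x y]]; rewrite /stitch_vertex /=.
  move=> /eh d; have := wF (x + 1); rewrite addrK => w.
  case: ifP => d'; rewrite /vertex_stitch /=.
    by rewrite d' d.
  by case: ifP => d1; [case: ifP => d2; rewrite ?addrK // | ]; exfalso; lia.
move=> /ev d; have := wG (y + 1); rewrite addrK => w.
case: ifP => d'; rewrite /vertex_stitch /=.
  by case: ifP => d1; [exfalso; lia | case: ifP => d2; rewrite ?addrK //;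
    exfalso; lia].
by rewrite d' d.
Qed.

Lemma stitch_vertex_endpoint s : endpoint s (stitch_vertex s).
Proof.
by move: s => [[] [x y]]; rewrite /stitch_vertex /endpoint /target /=; case: ifP;
  auto.
Qed.

Definition orbit_in (w h : nat) F G l v : {set 'I_w.+1 * 'I_h.+1} :=
  [set p : 'I_w.+1 * 'I_h.+1 | `[< orbit F G l v (p.1%:Z, p.2%:Z) >]].

Lemma orbit_stitches_image P (w h : nat) F G l v : walk F -> walk G ->
  encodes P F G l ->
  bbox (orbit F G l v) 0 w%:Z 0 h%:Z ->
  orbit_stitches P F G l v =
  [set` [fset vertex_stitch F G l ((val p.1)%:Z, (val p.2)%:Z)
    | p in enum (orbit_in w h F G l v)]%fset].
Proof.
move=> wF wG enc [b _ _ _ _]; apply/seteqP; split=> s /=.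
  move=> Os; have [Ps _] := Os.
  have ov := (orbit_stitch_ends v wF wG enc Ps (stitch_vertex_endpoint s)).2 Os.
  have := b _ ov; move E : (stitch_vertex s) ov => [x y] ov /= [xb yb].
  have xw : (absz x < w.+1)%N by lia.
  have yh : (absz y < h.+1)%N by lia.
  apply/imfsetP; exists (Ordinal xw, Ordinal yh) => /=.
    rewrite mem_enum inE; apply/asboolP.
    by rewrite !gez0_abs //; lia.
  rewrite !gez0_abs; try lia.
  by rewrite -E (stitch_vertexK wF wG enc Ps).
move=> /imfsetP[p /=]; rewrite mem_enum inE => /asboolP op ->.
have [eh ev] := enc; have := vertex_stitchK F G l (p.1%:Z, p.2%:Z).
set s' := vertex_stitch _ _ _ _ => e.
suff Ps : P s'.
  apply/(orbit_stitch_ends v wF wG enc Ps (stitch_vertex_endpoint s')).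
  by rewrite e.
rewrite /s' /vertex_stitch /=; move: (p.1%:Z) (p.2%:Z) => x y.
case: ifP => _.
  case: ifP => d; first exact/eh.
  by apply/eh; have := wF x; lia.
case: ifP => d; first exact/ev.
by apply/ev; have := wG y; lia.
Qed.

Lemma loop_length_orbit (R : realType) P (L : set (R * R)) (w h : nat) F G l v :
  walk F -> walk G -> encodes P F G l -> bbox (orbit F G l v) 0 w%:Z 0 h%:Z ->
  L = stitch_union (orbit_stitches P F G l v) ->
  finite_set (stitches L) /\ loop_length L = #|orbit_in w h F G l v|.
Proof.
move=> wF wG enc bS ->; rewrite /loop_length stitches_union.
rewrite (orbit_stitches_image wF wG enc bS); split; first exact: finite_fset.
rewrite set_fsetK (perm_size (enum_imfset _ _)) /=.
  by rewrite size_map undup_id ?enum_uniq // -cardE.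
move=> [x y] [x' y'] _ _ /(can_inj (vertex_stitchK F G l)) [ex ey].
by congr pair; apply/val_inj.
Qed.

(** * The bound *)

Implicit Types (n c d : int).
Definition excursion F w n : Prop :=
  [/\ walk F, F 0 = 0 /\ F (w - 1) = 0, F (- 1) = - 1 /\ F w = - 1,
      forall x, 0 <= x < w -> 0 <= F x <= n &
      exists2 x : int, 0 <= x < w & F x = n].

Definition looped F G n v w h : Prop :=
  [/\ excursion F w n, excursion G h n, level F G n v &
      bbox (orbit F G n v) 0 w 0 h].

Lemma normal_looped P w h F G n v : normal P w h F G n v -> looped F G n v w h.
Proof.
case=> -[wF wG] _ lev bS [[[a1 a2 a3 a4] [b1 b2 b3 b4] [c1 c2] [d1 d2]] F0 G0].
rewrite F0 G0 subr0 in a1 a2 a3 a4 b1 b2 b3 b4 c1 c2 d1 d2.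
rewrite !sub0r in a3 b3.
split=> //; split=> //.
- by rewrite a4 -a1 sub0r.
- by move=> x x_in; have := a2 x x_in; have := c1 x x_in; lia.
- by rewrite b4 -b1 sub0r.
- by move=> x x_in; have := b2 x x_in; have := d1 x x_in; lia.
Qed.

Lemma orbit_swap F G n v u : orbit F G n v u -> orbit G F n (flipxy v) (flipxy u).
Proof.
case: v u => [a b] [c d] o Q stQ Qv.
exact: o (@stable_swap G F n Q stQ) Qv.
Qed.

Lemma looped_swap F G n v w h :
  looped F G n v w h -> looped G F n (flipxy v) h w.
Proof.
case=> eF eG lev bS; split=> //; first by rewrite level_swap.
have -> : orbit G F n (flipxy v) = swapped (orbit F G n v).
  apply/funext => u; apply/propext; split=> [/orbit_swap|/orbit_swap].
    by case: (v).
  by rewrite /swapped; case: (u).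
exact: bbox_swap.
Qed.

Section Excursion.
Variables (F : int -> int) (w n : int).
Hypothesis eF : excursion F w n.

Lemma excursion_width : 0 < w.
Proof. by case: eF => _ _ _ _ [x]; lia. Qed.

Lemma top_excursion x : 0 <= x <= w -> 0 <= top F x <= n.
Proof.
case: eF => wF [F0 F1] [Fl Fr] b _ x_in; rewrite /top.
have [->|x0] := eqVneq x 0; first by rewrite sub0r F0 Fl; have := b 0;
  rewrite F0; have := excursion_width; lia.
have := b (x - 1); have [->|xw] := eqVneq x w; first by rewrite Fr; lia.
by have := b x; lia.
Qed.

Lemma top_excursion0 : top F 0 = 0.
Proof. by case: eF => _ [F0 _] [Fl _] _ _; rewrite /top sub0r F0 Fl. Qed.

Lemma top_excursion_last : top F w = 0.
Proof. by case: eF => _ [_ F0] [_ Fl] _ _; rewrite /top F0 Fl. Qed.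

Lemma top_excursion_gt0 x : 0 < x < w -> 0 < top F x.
Proof.
case: eF => wF _ _ b _ x_in; rewrite /top; have := wF x.
by have := b x; have := b (x - 1); lia.
Qed.

Lemma excursion_parity x : (2 %| F x - x)%Z.
Proof. by case: eF => wF [F0 _] _ _ _; have := walk_parity x wF;
  rewrite F0 subr0. Qed.

End Excursion.

Definition rectangle (w h : nat) F G n : {set 'I_w.+1 * 'I_h.+1} :=
  [set p : 'I_w.+1 * 'I_h.+1 | level F G n (p.1%:Z, p.2%:Z)].

Definition tops (w : nat) F n : {set 'I_w.+1} :=
  [set x : 'I_w.+1 | top F x%:Z == n].

Definition border (w : nat) : {set 'I_w.+1} :=
  [set x : 'I_w.+1 | (x == 0%N :> nat) || (x == w :> nat)].

Lemma card_border w : (0 < w)%N -> #|border w| = 2%N.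
Proof.
move=> w_gt0; have -> : border w = [set (ord0 : 'I_w.+1); ord_max]%SET.
  by apply/setP => x; rewrite !inE -!val_eqE.
by rewrite cards2 -val_eqE /= eq_sym -lt0n w_gt0.
Qed.

Lemma tops_inner (w : nat) F n : excursion F w%:Z n -> 0 < n ->
  tops w F n \subset ~: border w.
Proof.
move=> eF n_gt0; apply/fintype.subsetP => x; rewrite !inE => /eqP tx.
by apply/negP => /orP[] /eqP e; move: tx;
  rewrite e ?(top_excursion0 eF) ?(top_excursion_last eF); lia.
Qed.

Lemma peak_inner (w : nat) F n c : excursion F w%:Z n -> 0 < n ->
  0 <= c < w%:Z -> F c = n ->
  [/\ 0 < c, c + 1 < w%:Z, top F c = n & top F (c + 1) = n].
Proof.
move=> eF n_gt0 c_in Fc; case: (eF) => wF [F0 F1] [Fl Fr] b _.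
have c0 : c <> 0 by move=> e; move: Fc; rewrite e F0; lia.
have c1 : c <> w%:Z - 1 by move=> e; move: Fc; rewrite e F1; lia.
have := b (c - 1); have := b (c + 1); rewrite /top addrK.
by split; lia.
Qed.

Definition single_peak F w n := exists2 c : int, 0 <= c < w
  & forall x, 0 <= x < w -> F x = n <-> x = c.

(** A peak at the column [c] is seen from both lines [c] and [c + 1]. *)
Lemma card_tops_ge2 (w : nat) F n : excursion F w%:Z n -> 0 < n ->
  (2 <= #|tops w F n|)%N /\ (#|tops w F n| = 2%N <-> single_peak F w%:Z n).
Proof.
move=> eF n_gt0; have [_ _ _ _ [c c_in Fc]] := eF.
pose o x : 'I_w.+1 := inord (absz x).
have oE x : 0 <= x <= w%:Z -> (o x)%:Z = x by move=> ?; rewrite /o inordK; lia.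
have o_tops x : 0 <= x < w%:Z -> F x = n ->
  o x \in tops w F n /\ o (x + 1) \in tops w F n.
  move=> x_in Fx; have [x0 xw t t1] := peak_inner eF n_gt0 x_in Fx.
  by rewrite !inE !oE ?t ?t1 ?eqxx; lia.
have o_neq x y : 0 <= x <= w%:Z -> 0 <= y <= w%:Z -> x != y -> o x != o y.
  by move=> x_in y_in; apply: contra => /eqP e; rewrite -(oE x) // -(oE y) // e.
have [tc tc1] := o_tops c c_in Fc.
have sub : [set o c; o (c + 1)%R]%SET \subset tops w F n.
  by apply/fintype.subsetP => x; rewrite !inE => /orP[] /eqP ->;
    [move: tc | move: tc1]; rewrite inE.
have two : #|[set o c; o (c + 1)%R]%SET| = 2%N by rewrite cards2 o_neq; lia.
split; first by rewrite -two subset_leq_card.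
split=> [card2|[c' c'_in c'P]].
  exists c => // x x_in; split=> [Fx|-> //].
  have e : [set o c; o (c + 1)%R]%SET = tops w F n.
    by apply/eqP; rewrite eqEcard sub two card2.
  have [] := o_tops x x_in Fx; rewrite -e !inE => /orP[] /eqP ex /orP[] /eqP ex1;
    have := oE x; have := oE (x + 1); have := oE c; have := oE (c + 1);
      rewrite ex ex1; lia.
have ec : c = c' by apply/c'P.
suff -> : tops w F n = [set o c; o (c + 1)%R]%SET by [].
apply/eqP; rewrite finset.eqEsubset sub andbT; apply/fintype.subsetP => x;
  rewrite !inE => /eqP tx.
have x0 : (0 < x < w)%N.
  have := fintype.subsetP (tops_inner eF n_gt0) x; rewrite !inE tx eqxx => /(_ isT).
  by have := ltn_ord x; lia.
have : F (x%:Z - 1) = n \/ F x%:Z = n by move: tx; rewrite /top; lia.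
have ordE y : x%:Z = y -> x == o y by move=> <-; rewrite -val_eqE /= inordK; lia.
case=> /c'P e; apply/orP; [right | left]; apply: ordE; rewrite ec -e; lia.
Qed.

(** The equation says that [t + (a - 2) * (b - 2) = c + 4]. *)
Lemma frame_bound (t a b c : nat) :
  (t + a * b = 2 * b + 2 * a + c -> 1 < a -> 1 < b ->
  t <= c + 4 /\ (t = c + 4 <-> a = 2 \/ b = 2))%N.
Proof.
move=> e a2 b2; have {e} : (t + (a - 2) * (b - 2) = c + 4)%N by nia.
move: (a2) (b2); rewrite -subn_eq0 -(subnK a2) -(subnK b2) !addnK.
move: (a - 2)%N (b - 2)%N => {a2 b2} a' b' _ _ e; split; first by lia.
by split=> [e'|[e'|e']]; nia.
Qed.

Section Count.
Variables (w h : nat) (F G : int -> int) (n : int) (v : int * int).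
Hypotheses (lp : looped F G n v w%:Z h%:Z) (n_ge2 : 2 <= n).

Let A := tops w F n.
Let B := tops h G n.
(* Border points next to a peak of the other walk, and inner points that are
   not next to a peak of both. *)
Let T := finset.setX (border w) B :|: finset.setX A (border h) :|:
  (finset.setX (~: border w) (~: border h) :\: finset.setX A B).

Let eF : excursion F w%:Z n. Proof. by case: lp. Qed.
Let eG : excursion G h%:Z n. Proof. by case: lp. Qed.

Lemma card_frame : (#|T| + #|A| * #|B| =
  2 * #|B| + 2 * #|A| + (w - 1) * (h - 1))%N /\
    (#|A| * #|B| <= (w - 1) * (h - 1))%N.
Proof.
have n_gt0 : 0 < n by lia.
have w_gt0 : (0 < w)%N by have := excursion_width eF; lia.
have h_gt0 : (0 < h)%N by have := excursion_width eG; lia.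
have sA := tops_inner eF n_gt0; have sB := tops_inner eG n_gt0.
have cC (m : nat) : (0 < m)%N -> #|~: border m| = (m - 1)%N.
  by move=> m_gt0; rewrite cardsCs finset.setCK card_border // card_ord; lia.
have sAB : finset.setX A B \subset finset.setX (~: border w) (~: border h).
  by apply/fintype.subsetP => -[x y];
    rewrite !finset.in_setX => /andP[/(fintype.subsetP sA) ->
      /(fintype.subsetP sB) ->].
have cAB := subset_leq_card sAB; rewrite !cardsX !cC // in cAB; split=> //.
rewrite /T cardsU (_ : _ :&: _ = finset.set0) ?cards0 ?subn0; last first.
  apply/setP => p; rewrite !inE; case: p => x y /=.
  by do 2 case: (_ || (_ == _ :> nat)); rewrite ?andbF ?andbT /= ?andbF.
rewrite cardsU (_ : _ :&: _ = finset.set0) ?cards0 ?subn0; last first.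
  apply/setP => -[x y]; rewrite finset.in_setI !finset.in_setX finset.in_set0.
  apply/negP => /andP[/andP[bx _] /andP[/(fintype.subsetP sA)]].
  by rewrite inE bx.
rewrite cardsD (finset.setIidPr sAB) !cardsX !cC // !card_border //; lia.
Qed.

Lemma level_inner x y : 0 <= x <= w%:Z -> 0 <= y <= h%:Z -> level F G n (x, y) ->
  ((x = 0 \/ x = w%:Z) /\ top G y = n) \/ ((y = 0 \/ y = h%:Z) /\ top F x = n) \/
  (0 < x < w%:Z /\ 0 < y < h%:Z) /\ ~ (top F x = n /\ top G y = n).
Proof.
move=> x_in y_in; rewrite /level /=.
have := top_excursion eF x_in; have := top_excursion eG y_in.
have := top_excursion0 eF; have := top_excursion0 eG.
have := top_excursion_last eF; have := top_excursion_last eG.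
have [->|x0] := eqVneq x 0; first by left; split; [left | lia].
have [->|xw] := eqVneq x w%:Z; first by left; split; [right | lia].
have [->|y0] := eqVneq y 0; first by right; left; split; [left | lia].
have [->|yh] := eqVneq y h%:Z; first by right; left; split; [right | lia].
by move=> *; right; right; split; lia.
Qed.

Lemma rectangle_sub : rectangle w h F G n \subset T.
Proof.
apply/fintype.subsetP => -[x y]; rewrite inE /= => lev.
have xw := ltn_ord x; have yh := ltn_ord y.
have := @level_inner x%:Z y%:Z _ _ lev; rewrite !inE /=.
case=> [||[xb ty]|]; [lia | lia | | ].
  by rewrite ty eqxx andbT; apply/orP; left; apply/orP; left; lia.
case=> [[yb tx]|[xy nt]].
  by rewrite tx eqxx /=; apply/orP; left; apply/orP; right; lia.
by apply/orP; right; apply/andP; split;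
  [apply/negP => /andP[/eqP ? /eqP ?]; tauto | lia].
Qed.

Lemma rectangle_full : n = 2 -> rectangle w h F G n = T.
Proof.
move=> n2; apply/eqP; rewrite finset.eqEsubset rectangle_sub /=.
have border_top (m : nat) K (z : 'I_m.+1) : excursion K m%:Z n ->
  z \in border m -> top K z%:Z = 0.
  by move=> eK; rewrite inE => /orP[]/eqP ->;
    rewrite ?(top_excursion0 eK) ?(top_excursion_last eK).
have inner_top (m : nat) K (z : 'I_m.+1) : excursion K m%:Z n ->
  z \in ~: border m ->
    top K z%:Z = 1 \/ top K z%:Z = 2.
  move=> eK; rewrite !inE => zb; have zm := ltn_ord z.
  have := top_excursion_gt0 eK (x := z%:Z); have := top_excursion eK (x := z%:Z);
    lia.
apply/fintype.subsetP => -[x y]; rewrite inE => /orP[|].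
  rewrite inE => /orP[]; rewrite !finset.in_setX /= => /andP[h1 h2].
    by move: h2; rewrite !inE /level /= (border_top _ _ _ eF h1) => /eqP ->; lia.
  by move: h1; rewrite !inE /level /= (border_top _ _ _ eG h2) => /eqP ->; lia.
rewrite finset.in_setD !finset.in_setX /= => /andP[nAB /andP[h1 h2]]; move: nAB;
  rewrite !inE /level /=.
have := inner_top _ _ _ eF h1; have := inner_top _ _ _ eG h2; lia.
Qed.

(** The point [(1, 1)], where both tops are 1, is on the contour only if
    [n <= 2]. *)
Lemma rectangle_proper : (2 <= w)%N -> (2 <= h)%N -> n <> 2 ->
  rectangle w h F G n \proper T.
Proof.
move=> w2 h2 n2; rewrite properE rectangle_sub /=;
  apply/negP => /fintype.subsetP sub.
have one (m : nat) K : (2 <= m)%N -> excursion K m%:Z n -> top K 1 = 1.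
  move=> m2 eK; have := top_excursion_gt0 eK (x := 1).
  case: eK => wK [K0 _] _ _ _; rewrite /top subrr K0; have := wK 1;
    rewrite subrr K0; lia.
have := sub (inord 1, inord 1); rewrite !inE /level /= !inordK //; try lia.
by rewrite (one _ _ w2 eF) (one _ _ h2 eG); lia.
Qed.

Lemma orbit_in_sub : orbit_in w h F G n v \subset rectangle w h F G n.
Proof.
apply/fintype.subsetP => p; rewrite !inE => o.
have wF : walk F by case: eF.
have wG : walk G by case: eG.
have lv : level F G n v by case: lp.
by have [lev _ _] := orbit_component wF wG lv; exact: (lev _ o).
Qed.

(** The orbit is contained in the contour points of the rectangle, and these in
    [T]; equality of the lengths means equality of all three sets. *)
Lemma card_orbit_in : (2 <= w)%N -> (2 <= h)%N ->
  (#|orbit_in w h F G n v| <= (w - 1) * (h - 1) + 4)%N /\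
  (#|orbit_in w h F G n v| = (w - 1) * (h - 1) + 4 <->
   [/\ n = 2, orbit_in w h F G n v = rectangle w h F G n &
       single_peak F w%:Z n \/ single_peak G h%:Z n])%N.
Proof.
move=> w2 h2; have n_gt0 : 0 < n by lia.
have [A2 AP] := card_tops_ge2 eF n_gt0; have [B2 BP] := card_tops_ge2 eG n_gt0.
rewrite -/A in A2 AP; rewrite -/B in B2 BP.
have [cT leAB] := card_frame.
have le1 := subset_leq_card orbit_in_sub; have le2 := subset_leq_card rectangle_sub.
have [T4 TP] := frame_bound cT A2 B2.
split; first exact: leq_trans le1 (leq_trans le2 T4).
split=> [e|[n2 e pk]].
  have eT : #|T| = ((w - 1) * (h - 1) + 4)%N.
    by apply/eqP; rewrite eqn_leq T4 -e; exact: leq_trans le1 le2.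
  have le3 : (#|T| <= #|rectangle w h F G n|)%N by rewrite eT -e.
  have n2 : n = 2.
    apply: contrapT => /(rectangle_proper w2 h2)/proper_card.
    by rewrite ltnNge le3.
  split=> //.
    by apply/eqP; rewrite eqEcard orbit_in_sub e -eT.
  by move/TP: eT => [/AP|/BP]; [left | right].
rewrite e (rectangle_full n2).
by apply/TP; case: pk => [/AP eA|/BP eB]; [left | right].
Qed.

End Count.

(** * The loops through all contour points of their box *)

Implicit Types (w h : int).
Definition fills F G n v w h :=
  forall u, 0 <= u.1 <= w -> 0 <= u.2 <= h -> level F G n u -> orbit F G n v u.

Lemma fills_swap F G n v w h : fills F G n v w h -> fills G F n (flipxy v) h w.
Proof.
move=> fl [a b] /= ain bin lev.
by apply: (@orbit_swap F G n v (b, a)); apply: fl => //; rewrite -level_swap.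
Qed.

Lemma fills_rectangle (w h : nat) F G n v : looped F G n v w%:Z h%:Z ->
  orbit_in w h F G n v = rectangle w h F G n <-> fills F G n v w%:Z h%:Z.
Proof.
move=> lp; split=> [e [x y] /= x_in y_in lev|fl].
  have xw : (absz x < w.+1)%N by lia.
  have yh : (absz y < h.+1)%N by lia.
  have /setP/(_ (Ordinal xw, Ordinal yh)) := e; rewrite !inE /= !gez0_abs; try lia.
  by rewrite lev => /asboolP.
apply/eqP; rewrite finset.eqEsubset (orbit_in_sub lp) /=.
apply/fintype.subsetP => -[x y]; rewrite !inE /= => lev.
by apply: fl => //=; have := ltn_ord x; have := ltn_ord y; lia.
Qed.

(** In an excursion of height 2 the values beside a height 1 are 0 or 2, and the
    equation says that they differ. *)
Definition zigzag G h := forall y, 0 < y < h - 1 -> G y = 1 ->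
  G (y - 1) + G (y + 1) = 2.

(** The hypotheses say that the four sides of the cell [(x, y)] are stitches of
    level [n]. *)
Lemma stable_square F G n x y :
  F x + top G y = n -> F x + top G (y + 1) = n ->
  top F x + G y = n -> top F (x + 1) + G y = n -> walk F -> walk G ->
  stable F G n (fun u => x <= u.1 <= x + 1 /\ y <= u.2 <= y + 1).
Proof.
move=> e1 e2 e3 e4 wF wG [a b] /= [ax yb].
have wx := wF x; have wy := wG y; have := wF (x + 1); have := wG (y + 1).
rewrite !addrK => wy1 wx1; rewrite /hn /vn /hn /flipxy /=.
have [->|->] : a = x \/ a = x + 1 by lia.
  have [->|->] : b = y \/ b = y + 1 by lia.
    by split; case: ifP => d /=; lia.
  by split; case: ifP => d /=; lia.
have [->|->] : b = y \/ b = y + 1 by lia.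
  by split; case: ifP => d /=; lia.
by split; case: ifP => d /=; lia.
Qed.

Lemma looped_no_square F G n v w h x y : looped F G n v w h -> 1 < w ->
  orbit F G n v (x, y) ->
  F x + top G y = n -> F x + top G (y + 1) = n ->
  top F x + G y = n -> top F (x + 1) + G y = n -> False.
Proof.
move=> [eF eG lev [b [y0 o0] [y1 o1] _ _]] w1 oxy e1 e2 e3 e4.
have wF : walk F by case: eF.
have wG : walk G by case: eG.
have [_ _ cn] := orbit_component wF wG lev.
have st := stable_square e1 e2 e3 e4 wF wG.
have := cn _ (x, y) st oxy _ _ o0; have := cn _ (x, y) st oxy _ _ o1.
rewrite /= => /(_ ltac:(lia)) h1 /(_ ltac:(lia)) h0; lia.
Qed.

Lemma excursion_range F w x : excursion F w 2 -> 0 <= x < w ->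
  (F x = 0 \/ F x = 1 \/ F x = 2) /\ (2 %| F x - x)%Z.
Proof.
move=> eF x_in; split; last exact: (excursion_parity eF x).
by case: eF => _ _ _ /(_ x x_in); lia.
Qed.

(** Where [G] fails to zigzag, next to a row [y] of height 1, an island needs a
    column of height 1 that is not next to the peak [c], and a hole an inner
    column of height 0; both exist in width at least 7. *)
Lemma fills_zigzag F G v w h : looped F G 2 v w h -> single_peak F w 2 ->
  5 <= w -> fills F G 2 v w h -> w = 5 \/ zigzag G h.
Proof.
move=> lp [c c_in cP] w5 fl; have [eF eG _ _] := lp.
have [->|wn5] := eqVneq w 5; [by left | right].
have [_ [_ F1] _ _ _] := eF.
have w7 : 7 <= w by have := excursion_parity eF (w - 1); rewrite F1; lia.
have low x : 0 <= x < w -> (2 %| x)%Z -> x != c -> F x = 0.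
  move=> x_in xe xc; have := excursion_range eF x_in.
  suff : F x <> 2 by lia.
  by move/(cP x x_in); apply/eqP.
have odd1 x : 0 <= x < w -> ~~ (2 %| x)%Z -> F x = 1.
  by move=> x_in xo; have := excursion_range eF x_in; lia.
have ce : (2 %| c)%Z.
  by have := excursion_parity eF c; rewrite (cP c c_in).2 //; lia.
move=> y y_in Gy; have := excursion_range eG (x := y - 1).
have := excursion_range eG (x := y + 1); have := excursion_parity eG y; rewrite Gy.
move=> yo /(_ ltac:(lia)) r1 /(_ ltac:(lia)) r0.
have [] : G (y - 1) + G (y + 1) = 2 \/
  (G (y - 1) = 0 /\ G (y + 1) = 0) \/ (G (y - 1) = 2 /\ G (y + 1) = 2) by lia.
  by [].
have tx x : top F (x + 1) = Num.max (F x) (F (x + 1)) by rewrite /top addrK.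
have ty : top G (y + 1) = Num.max (G y) (G (y + 1)) by rewrite /top addrK.
have yh : 0 <= y <= h by lia.
case=> -[g0 g1]; exfalso.
  (* Among the columns 1, 3 and 5, one is not next to [c]. *)
  have [d [d_in dF dl dr]] : exists d,
    [/\ 0 < d < w - 1, F d = 1, F (d - 1) = 0 & F (d + 1) = 0].
    have [c2|c2] := eqVneq c 2.
      exists 5; split; [|rewrite odd1|rewrite low|rewrite low]; lia.
    have [c4|c4] := eqVneq c 4.
      exists 1; split; [|rewrite odd1|rewrite low|rewrite low]; lia.
    have [c0|c0] := eqVneq c 0.
      exists 3; split; [|rewrite odd1|rewrite low|rewrite low]; lia.
    exists 1; split; [|rewrite odd1|rewrite low|rewrite low]; lia.
  have e1 : F d + top G y = 2 by rewrite /top; lia.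
  have e2 : F d + top G (y + 1) = 2 by rewrite ty; lia.
  have e3 : top F d + G y = 2 by rewrite /top; lia.
  have e4 : top F (d + 1) + G y = 2 by rewrite tx; lia.
  apply: (looped_no_square lp _ _ e1 e2 e3 e4); first by lia.
  by apply: fl => /=; [lia | lia | rewrite /level /=; lia].
(* The columns 2 and 4 cannot both be [c]. *)
have [d [d_in dF dl dr]] : exists d,
  [/\ 0 < d < w - 1, F d = 0, F (d - 1) = 1 & F (d + 1) = 1].
  have [c2|c2] := eqVneq c 2.
    exists 4; split; [|rewrite low|rewrite odd1|rewrite odd1]; lia.
  exists 2; split; [|rewrite low|rewrite odd1|rewrite odd1]; lia.
have e1 : F d + top G y = 2 by rewrite /top; lia.
have e2 : F d + top G (y + 1) = 2 by rewrite ty; lia.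
have e3 : top F d + G y = 2 by rewrite /top; lia.
have e4 : top F (d + 1) + G y = 2 by rewrite tx; lia.
apply: (looped_no_square lp _ _ e1 e2 e3 e4); first by lia.
by apply: fl => /=; [lia | lia | rewrite /level /=; lia].
Qed.

Lemma hn_rectangle F G n w h u : excursion F w n -> excursion G h n ->
  0 <= u.1 <= w -> 0 <= u.2 <= h -> level F G n u ->
  0 <= (hn F G n u).1 <= w.
Proof.
move=> eF eG; case: u => x y /= x_in y_in lev.
have wF : walk F by case: eF.
have wG : walk G by case: eG.
have [_ _ [Fl Fr] _ _] := eF; have := top_excursion eG y_in.
have [_ /=] := hn_level wF wG lev; case=> -[-> /= e].
  by have [xw|?] := eqVneq x w; [move: e; rewrite xw Fr; lia | lia].
by have [x0|?] := eqVneq x 0; [move: e; rewrite x0 sub0r Fl; lia | lia].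
Qed.

Lemma rectangle_stable F G n w h : excursion F w n -> excursion G h n ->
  stable F G n (fun u => [/\ 0 <= u.1 <= w, 0 <= u.2 <= h & level F G n u]).
Proof.
move=> eF eG [x y] [/= x_in y_in lev].
have wF : walk F by case: eF.
have wG : walk G by case: eG.
have [lh _] := hn_level wF wG lev;
  have inh := hn_rectangle (u := (x, y)) eF eG x_in y_in lev.
have lev' : level G F n (y, x) by rewrite -level_swap.
have [lv _] := hn_level wG wF lev';
  have inv := hn_rectangle (u := (y, x)) eG eF y_in x_in lev'.
split; first by split=> //; rewrite (hn_lines F G n (x, y)).1.
rewrite /vn /flipxy /=; split=> //.
  by rewrite /= (hn_lines G F n (y, x)).1.
by rewrite -level_swap /flipxy /= -surjective_pairing.
Qed.

(** The component of a contour point [u] has the shape given by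
    [component_mound] in its own bounding box.  If it is not flipped and its box
    is the whole rectangle, it contains the bottom of the peak column, like the
    orbit of [v].  In the other cases, the heights between 0 and 2 and
    the single peak leave at most a box of one cell, next to which [G] takes the
    same value twice; this contradicts [zigzag G h] and, when [w = 5], there is
    no room for such a cell beside the peak. *)
Lemma zigzag_fills F G v w h : looped F G 2 v w h -> single_peak F w 2 ->
  w = 5 \/ zigzag G h -> fills F G 2 v w h.
Proof.
move=> lp [c c_in cP] wz u ux uy lev; have [eF eG levv bS] := lp.
have wF : walk F by case: eF.
have wG : walk G by case: eG.
have cU := orbit_component wF wG lev; have cV := orbit_component wF wG levv.
have inU (t : int * int) : orbit F G 2 u t ->
  [/\ 0 <= t.1 <= w, 0 <= t.2 <= h & level F G 2 t].
  by move=> o; apply: (o _ (rectangle_stable eF eG)).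
have [x0 [x1 [y0 [y1 bU]]]] : exists x0 x1 y0 y1, bbox (orbit F G 2 u) x0 x1 y0 y1.
  apply: (@bbox_exists _ u (w + h)) => [Q //|t /inU[]]; lia.
have [Fc Fc'] : F c = 2 /\ forall x, 0 <= x < w -> F x = 2 -> x = c.
  by split=> [|x x_in]; [exact: (cP c c_in).2 | exact: (cP x x_in).1].
have [b [ya /inU[/= x0in _ _]] [yb /inU[/= x1in _ _]] [xa /inU[_ /= y0in _]]
  [xb /inU[_ /= y1in _]]] := bU.
have [ltx _] := crosses_of_component wF wG cU bU.
have [lty _] := crosses_of_component wG wF (component_swap cU) (bbox_swap bU).
have [_ [F0 F1] [Fl Fr] bF _] := eF; have [_ [G0 G1] [Gl Gr] bG [i i_in Gi]] := eG.
have five : w = 5 -> [/\ F 1 = 1, F 2 = 2 & F 3 = 1].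
  move=> w5; have c2 : c = 2.
    have := excursion_parity eF c; rewrite Fc w5 in c_in * => pc.
    have [e|e] := eqVneq c 0; first by move: Fc; rewrite e F0.
    have [e'|e'] := eqVneq c 4; last by lia.
    by move: F1; rewrite w5 (_ : 5 - 1 = c) ?Fc //; lia.
  have := excursion_range (x := 1) eF; have := excursion_range (x := 3) eF.
  by rewrite -[in F 2]c2 Fc; split; lia.
have Fge0 x : - 1 <= x <= w -> F x < 0 -> x = - 1 \/ x = w.
  by move=> x_in neg; have := bF x; lia.
have Gge0 y : - 1 <= y <= h -> G y < 0 -> y = - 1 \/ y = h.
  by move=> y_in neg; have := bG y; lia.
have bFx0 := bF x0; have bGy0 := bG y0.
have [[[a1 a2 a3 a4] [b1 b2 b3 b4] [c1 c2] [d1 d2]]|] :=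
  component_mound wF wG cU bU.
  have [f0|f0] := eqVneq (F x0) 0; have [g0|g0] := eqVneq (G y0) 0.
  (* Only the columns and rows next to the rectangle have negative heights, so
     a box whose end heights are 0 is the whole rectangle. *)
  - have ex0 : x0 = 0 by have := Fge0 (x0 - 1); lia.
    have ex1 : x1 = w by have := Fge0 x1; lia.
    have ey0 : y0 = 0 by have := Gge0 (y0 - 1); lia.
    have ey1 : y1 = h by have := Gge0 y1; lia.
    have bottom (t : int * int) : level F G 2 t ->
      bbox (orbit F G 2 t) 0 w 0 h -> orbit F G 2 t (c, 0).
      move=> levt bt; have ct := orbit_component wF wG levt.
      have [y [y' [ne Sy Sy' hy hy']]] := column_crossed_twice wF wG ct bt c_in.
      have end_row z : orbit F G 2 t (c, z) -> hn F G 2 (c, z) = (c + 1, z) ->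
        z = 0 \/ z = h.
        move=> oz hz; have [levt' _ _] := ct; have := levt' _ oz.
        move=> /(hn_level wF wG)[_]; rewrite hz /= => -[[_ e]|[[e _]]]; last by lia.
        have zin : 0 <= z <= h by case: bt => bt _ _ _ _; have := bt _ oz;
          rewrite /=; lia.
        have [z0|z0] := eqVneq z 0; first by left.
        have [zh|zh] := eqVneq z h; first by right.
        by have := top_excursion_gt0 eG (x := z); lia.
      have [e|e] := end_row _ Sy hy; first by rewrite e in Sy.
      have [e'|e'] := end_row _ Sy' hy'; first by rewrite e' in Sy'.
      by move: ne; rewrite e e' eqxx.
    have oV := bottom v levv bS; have oU := bottom u lev.
    rewrite ex0 ex1 ey0 ey1 in bU; have {}oU := oU bU.
    have [_ stV _] := cV; have [_ _ cn] := cU.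
    by apply: (cn _ (c, 0) stV oU oV) => Q.
  - have ex0 : x0 = 0 by have := Fge0 (x0 - 1); lia.
    have ex1 : x1 = w by have := Fge0 x1; lia.
    by have := c1 c; lia.
  - have ey0 : y0 = 0 by have := Gge0 (y0 - 1); lia.
    have ey1 : y1 = h by have := Gge0 y1; lia.
    by have := d1 i; lia.
  (* An island: the box is one cell of heights 1 and 1. *)
  - exfalso; have e1 : F x0 = 1 /\ G y0 = 1 by have := c1 x0; have := d1 y0; lia.
    have ex1 : x1 = x0 + 1.
      have := a2 (x0 + 1); have := c1 (x0 + 1); have := wF (x0 + 1);
        rewrite addrK; lia.
    have ey1 : y1 = y0 + 1.
      have := b2 (y0 + 1); have := d1 (y0 + 1); have := wG (y0 + 1);
        rewrite addrK; lia.
    rewrite ex1 addrK in a4; rewrite ey1 addrK in b4.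
    have [w5|zz] := wz.
      have [f1 f2 f3] := five w5.
      have [x01|x03] : x0 = 1 \/ x0 = 3.
        by have := excursion_parity eF x0; lia.
      + have e : F (x0 + 1) = F 2 by congr F; lia.
        by lia.
      + have e : F (x0 - 1) = F 2 by congr F; lia.
        by lia.
    have y0h : 0 < y0 < h - 1.
      have [e|?] := eqVneq y0 0; first by move: e1.2; rewrite e G0.
      have [e|?] := eqVneq y0 (h - 1); last by lia.
      by move: e1.2; rewrite e G1.
    by have := zz y0 y0h e1.2; lia.
rewrite /flip /flip1 => -[[a1 a2 a3 a4] [b1 b2 b3 b4] [c1 c2] [d1 d2]]; exfalso.
have x0pos : 0 < x0.
  by have [e|?] := eqVneq x0 0; [move: a3; rewrite e sub0r Fl F0; lia | lia].
have y0pos : 0 < y0.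
  by have [e|?] := eqVneq y0 0; [move: b3; rewrite e sub0r Gl G0; lia | lia].
have x1w : x1 < w.
  have [e|?] := eqVneq x1 w; last by lia.
  by have := bF (x1 - 1); move: a4; rewrite e Fr; lia.
have y1h : y1 < h.
  have [e|?] := eqVneq y1 h; last by lia.
  by have := bG (y1 - 1); move: b4; rewrite e Gr; lia.
(* Both columns beside the box would be peaks. *)
have nF1 : F x0 <> 1.
  move=> e; have p0 : x0 - 1 = c by apply: Fc'; lia.
  have p1 : x1 = c by apply: Fc'; lia.
  by lia.
have := bF (x0 - 1); have := bG (y0 - 1) => bg bf.
have f0 : F x0 = 0 by lia.
have g1 : G y0 = 1 by have := c1 x0; lia.
have ex1 : x1 = x0 + 1.
  by have := a2 (x0 + 1); have := wF (x0 + 1); have := bF (x0 + 1);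
    rewrite addrK; lia.
have ey1 : y1 = y0 + 1.
  by have := b2 (y0 + 1); have := d1 (y0 + 1); have := wG (y0 + 1);
    rewrite addrK; lia.
rewrite ex1 addrK in a4; rewrite ey1 addrK in b4.
have [w5|zz] := wz.
  have [f1 f2 f3] := five w5.
  have [e|[e|e]] : x0 = 1 \/ x0 = 2 \/ x0 = 3 by lia.
  - by move: f0; rewrite e f1.
  - by move: f0; rewrite e f2.
  - by move: f0; rewrite e f3.
have := zz y0 ltac:(lia) g1; lia.
Qed.

Lemma length_extremal (w h : nat) F G n v : looped F G n v w%:Z h%:Z ->
  (5 <= w)%N -> (5 <= h)%N -> 2 <= n ->
  (#|orbit_in w h F G n v| <= (w - 1) * (h - 1) + 4)%N /\
  (#|orbit_in w h F G n v| = (w - 1) * (h - 1) + 4 <->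
   n = 2%Z /\ ((single_peak F w%:Z 2 /\ (w = 5 \/ zigzag G h%:Z)) \/
            (single_peak G h%:Z 2 /\ (h = 5 \/ zigzag F w%:Z))))%N.
Proof.
move=> lp w5 h5 n2; have [le_len eq_len] :=
  card_orbit_in lp n2 ltac:(lia) ltac:(lia).
split=> //; rewrite eq_len; split.
  move=> [en /(fills_rectangle lp) fl pk]; split=> //; rewrite en in lp fl pk.
  case: pk => pk; [left | right]; split=> //.
    by have [||] := fills_zigzag lp pk _ fl; [lia | left; lia | right].
  have lp' := looped_swap lp.
  by have [||] := fills_zigzag lp' pk _ (fills_swap fl); [lia | left; lia | right].
move=> [en pk]; rewrite en in lp *; split=> //; last by case: pk => -[? _];
  [left | right].
apply/fills_rectangle => //; case: pk => -[pk wz].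
  by apply: zigzag_fills lp pk _; case: wz => [->|]; [left | right].
have lp' := looped_swap lp.
have := zigzag_fills lp' pk; have wz' : h%:Z = 5 \/ zigzag F w by case: wz =>
  [->|]; [left | right].
by move=> /(_ wz')/fills_swap; case: (v).
Qed.

(** * Labels of the named loops *)

(** If [F 0 = G 0 = 0], the edge of the line [x] that begins on the axis has the
    larger sum [top F x] beside it; the label is 0 when this edge is a stitch. *)
Definition labels_of (e : int -> 'Z_2) F n :=
  forall x, e x = if (2 %| top F x - n)%Z then 0 else 1.

Lemma label_even e F n x : labels_of e F n -> (e x == 0) = (2 %| top F x - n)%Z.
Proof. by move=> ->; case: ifP. Qed.

Lemma label_if e F n x (b : bool) : labels_of e F n -> (2 %| top F x - n)%Z = b ->
  e x = if b then 0 else 1.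
Proof. by move=> -> ->. Qed.

Lemma label_eq0 e F n x : labels_of e F n -> e x = 0 -> (2 %| top F x - n)%Z.
Proof. by move=> he e0; rewrite -(label_even x he) e0. Qed.

Lemma label_eq1 e F n x : labels_of e F n -> e x = 1 -> ~~ (2 %| top F x - n)%Z.
Proof. by move=> he e1; rewrite -(label_even x he) e1. Qed.

Section Labels.
Variables (w h : nat) (F G : int -> int) (n : int) (eps eta : int -> 'Z_2).
Hypotheses (eF : excursion F w%:Z n) (eG : excursion G h%:Z n).
Hypotheses (heps : labels_of eps G n) (heta : labels_of eta F n).

Lemma rug_labels_of_height1 : n = 1 -> rug_labels w h eps eta.
Proof.
move=> n1; have lab (m : nat) (K : int -> int) (e : int -> 'Z_2) :
    excursion K m%:Z n -> labels_of e K n ->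
    forall i : nat, (i <= m)%N -> e i%:Z = if i \in [:: 0%N; m] then 1 else 0.
  move=> eK he i im; rewrite !inE.
  have t0 := top_excursion0 eK; have tm := top_excursion_last eK.
  have ti := top_excursion eK (x := i%:Z) ltac:(lia).
  have ti' := top_excursion_gt0 eK (x := i%:Z).
  rewrite (label_if (b := ~~ ((i == 0%N) || (i == m))) he); first by case: (_ || _).
  have [->|i0] := eqVneq i 0%N; first by rewrite t0 n1.
  by have [->|ne] := eqVneq i m; [rewrite tm n1 | lia].
by split; [exact: (lab h G eps eG heps) | exact: (lab w F eta eF heta)].
Qed.

Lemma wand_labels_of_height2 : n = 2 -> (w = 5)%N -> (5 <= h)%N -> odd h ->
  wand5_labels h eps eta.
Proof.
move=> n2 w5 h5 oh; have eF' := eF; have eG' := eG; rewrite w5 n2 in eF' eG'.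
have [wF [F0 F4] _ bF [c c_in Fc]] := eF'.
have [wG [G0 Gh] _ bG [d d_in Gd]] := eG'.
have rF (x : int) := excursion_range (x := x) eF'.
have rG (y : int) := excursion_range (x := y) eG'.
have F4' : F 4 = 0 by rewrite -F4; congr F; lia.
have F1 : F 1 = 1 by have := rF 1; lia.
have F3 : F 3 = 1 by have := rF 3; lia.
have F2 : F 2 = 2.
  have [e|[e|e]] : c = 2 \/ c = 0 \/ c = 4 by have := rF c; lia.
  - by rewrite -[in F 2]e.
  - by move: Fc; rewrite e F0.
  - by move: Fc; rewrite e F4'.
have t1 : top F 1 = 1 by rewrite /top (_ : 1 - 1 = 0) // F0 F1.
have t2 : top F 2 = 2 by rewrite /top (_ : 2 - 1 = 1) // F1 F2.
have t3 : top F 3 = 2 by rewrite /top (_ : 3 - 1 = 2) // F2 F3.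
have t4 : top F 4 = 1 by rewrite /top (_ : 4 - 1 = 3) // F3 F4'.
have t0 := top_excursion0 eF'; have t5 := top_excursion_last eF'.
have s0 := top_excursion0 eG'; have sh := top_excursion_last eG'.
have G_odd (y : int) : 0 <= y < h%:Z -> ~~ (2 %| y)%Z -> G y = 1.
  by move=> y_in yo; have := rG y; lia.
split.
- by split; [split | split]; rewrite heta ?t0 ?t1 ?t2 ?t3 ?t4 ?t5 n2.
- by split; rewrite heps ?s0 ?sh n2.
- split; rewrite heps.
    by rewrite /top (_ : 1 - 1 = 0) // G0 (G_odd 1) ?n2 //; lia.
  rewrite /top (_ : (h - 1)%N%:Z = h%:Z - 1) ?Gh; last by lia.
  by rewrite (G_odd (h%:Z - 1 - 1)) ?n2 //; lia.
- move=> i i_in; rewrite !heps; congr (if (2 %| _ - _)%Z then _ else _).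
  rewrite /top (_ : (2 * i + 1)%N%:Z - 1 = (2 * i)%N%:Z); last by lia.
  rewrite (G_odd ((2 * i)%N%:Z - 1)) ?(G_odd (2 * i + 1)%N%:Z)
    ?[Num.max 1 _]maxC //; lia.
have de : (2 %| d)%Z by have := rG d; lia.
have d0 : d <> 0 by move=> e; move: Gd; rewrite e G0.
have dh : d <> h%:Z - 1 by move=> e; move: Gd; rewrite e Gh.
exists (absz d)./2; first by lia.
rewrite heps (_ : (2 * _)%N%:Z = d); last by lia.
have := rG (d - 1); have := top_excursion eG' (x := d); rewrite /top Gd n2 => h1 h2.
rewrite (_ : (2 %| Num.max (G (d - 1)) 2 - 2)%Z) //; lia.
Qed.

Lemma peak_of_wand : (w = 5)%N -> wand5_labels h eps eta ->
  n = 2%Z /\ single_peak F w%:Z 2.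
Proof.
move=> w5 [[[e1 e4] [e0 e2 e3 e5]] _ _ _ _].
have eF' := eF; rewrite w5 in eF' *.
have [wF [F0 F4] _ bF [c c_in Fc]] := eF'.
have F4' : F 4 = 0 by rewrite -F4; congr F; lia.
have := label_eq0 heta e0; rewrite (top_excursion0 eF') => n_even.
have p (x : int) := excursion_parity eF' x.
have F1 : F 1 = 1.
  have := wF 1; rewrite (_ : 1 - 1 = 0) // F0 => ?; have := bF 1; lia.
have F2 : F 2 = 2.
  have := wF 2; rewrite (_ : 2 - 1 = 1) // F1 => w2.
  have := label_eq0 heta e2; rewrite /top (_ : 2 - 1 = 1) // F1; lia.
have F3 : F 3 = 1.
  have := wF 3; rewrite (_ : 3 - 1 = 2) // F2 => w2.
  have := label_eq0 heta e3; rewrite /top (_ : 3 - 1 = 2) // F2; lia.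
have val (x : int) : 0 <= x < 5 ->
  F x = if x == 2 then 2 else if (2 %| x)%Z then 0 else 1.
  move=> x_in; have : x = 0 \/ x = 1 \/ x = 2 \/ x = 3 \/ x = 4 by lia.
  by case=> [->|[->|[->|[->|->]]]]; rewrite ?F0 ?F1 ?F2 ?F3 ?F4'.
have n2 : n = 2 by have := val c c_in; have := bF 2; rewrite F2 Fc; case: ifP;
  [lia | case: ifP; lia].
split=> //; exists 2 => // x x_in; rewrite (val x x_in).
by split=> [|->]; rewrite ?eqxx //; case: eqP => //; case: ifP.
Qed.

(** The heights of the rows of a horizontal comb. *)
Definition wave (y : nat) : int := nth 0 [:: 0; 1; 2; 1] (y %% 4)%N.

Lemma waveE (y : nat) : wave y =
  if (y %% 4 == 2)%N then 2 else if odd y then 1 else 0.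
Proof.
have -> : odd y = odd (y %% 4)%N by lia.
by rewrite /wave; have := ltn_pmod y (isT : (0 < 4)%N);
  case: (y %% 4)%N => [|[|[|[|]]]].
Qed.

Lemma zigzag_wave : n = 2 -> zigzag G h%:Z ->
  forall y : nat, (y < h)%N -> G y%:Z = wave y.
Proof.
move=> n2 zz; have eG' := eG; rewrite n2 in eG'.
have [wG [G0 Gh] _ bG _] := eG'.
have G_odd (y : nat) : (y < h)%N -> odd y -> G y%:Z = 1.
  by move=> yh yo; have := excursion_range (x := y%:Z) eG'; lia.
move=> y; elim/ltn_ind: y => -[|[|y]] IHy yh.
- by rewrite G0.
- by rewrite G_odd.
rewrite waveE; have [yo|ye] := boolP (odd y).
  have yo2 : odd y.+2 by lia.
  by rewrite G_odd //; repeat (case: ifP => ?); lia.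
have := zz y.+1%:Z ltac:(lia); rewrite G_odd //=; last by lia.
have -> : y.+1%:Z - 1 = y%:Z by lia.
have -> : y.+1%:Z + 1 = y.+2%:Z by lia.
move=> /(_ erefl); rewrite (IHy y) ?waveE; try lia.
by repeat (case: ifP => ?); lia.
Qed.

Lemma comb_of_zigzag : n = 2 -> (5 <= w)%N -> (5 <= h)%N -> odd w -> odd h ->
  single_peak F w%:Z 2 -> zigzag G h%:Z ->
  exists alpha : nat, [/\ (h = 1 %[mod 4])%N, odd alpha /\ (3 <= alpha <= w - 2)%N &
    comb_labels w h alpha eps eta].
Proof.
move=> n2 w5 h5 ow oh [c c_in cP] zz; have wv := zigzag_wave n2 zz.
have eF' := eF; have eG' := eG; rewrite n2 in eF' eG'.
have [wF [F0 F1] _ bF _] := eF'; have [wG [G0 G1] _ bG _] := eG'.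
have Fc := (cP c c_in).2 erefl.
have [c0 c1 tc tc1] := peak_inner eF' isT c_in Fc.
have c_even : (2 %| c)%Z by have := excursion_parity eF' c; lia.
exists (absz c).+1; split.
- have := wv h.-1 ltac:(lia); rewrite waveE -(_ : h%:Z - 1 = h.-1%:Z) ?G1;
    last by lia.
  by repeat (case: ifP => ?); lia.
- have cw : c <> w%:Z - 1 by move=> e; move: Fc; rewrite e F1.
  by split; lia.
have s0 := top_excursion0 eG'; have sh := top_excursion_last eG'.
have t0 := top_excursion0 eF'; have tw := top_excursion_last eF'.
split; first by split; rewrite heps ?s0 ?sh n2.
- move=> i i_in; have top_i : top G i%:Z =
      if ((i %% 4 == 2) || (i %% 4 == 3))%N then 2 else 1.
    rewrite /top (_ : i%:Z - 1 = i.-1%:Z); last by lia.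
    rewrite !wv ?waveE; try lia.
    by repeat (case: ifP => ? /=); lia.
  by rewrite heps n2 top_i !inE; case: (_ || _).
move=> j jw; rewrite !inE heta n2.
have [->|j0] := eqVneq j 0%N; first by rewrite t0.
have [->|jw'] := eqVneq j w; first by rewrite tw !orbT.
have [jc|jc] := eqVneq j%:Z c; first by rewrite jc tc ifT //; lia.
have [jc1|jc1] := eqVneq j%:Z (c + 1); first by rewrite jc1 tc1 ifT //; lia.
have := top_excursion_gt0 eF' (x := j%:Z); have := top_excursion eF' (x := j%:Z).
have := wF j%:Z; have := cP j%:Z; have := cP (j%:Z - 1);
  rewrite /top => h1 h2 h3 h4 h5'.
have ne0 : F j%:Z <> 2 by move=> e; have := (h2 ltac:(lia)).1 e; lia.
have ne1 : F (j%:Z - 1) <> 2 by move=> e; have := (h1 ltac:(lia)).1 e; lia.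
by rewrite [in RHS]ifF; [rewrite ifF //; lia | lia].
Qed.

(** The label of the line [y] gives the parity of [top K y]; together with the
    parity of [K y] it tells whether the walk goes up or down at [y]. *)
Lemma walk_of_labels (K : int -> int) (m : nat) (e : int -> 'Z_2) (g : nat -> int) :
  walk K -> labels_of e K n -> (2 %| n)%Z -> (forall x, 2 %| K x - x)%Z ->
    K 0 = g 0%N ->
  (forall y : nat, (0 < y < m)%N ->
    (e y%:Z = 0 /\ ((g y = g y.-1 + 1 /\ ~~ odd y) \/ (g y = g y.-1 - 1 /\
      odd y))) \/
    (e y%:Z = 1 /\ ((g y = g y.-1 + 1 /\ odd y) \/ (g y = g y.-1 - 1 /\
      ~~ odd y)))) ->
  forall y : nat, (y < m)%N -> K y%:Z = g y.
Proof.
move=> wK he ne pK K0 step; elim=> [|y IHy] ym //.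
have := step y.+1 ym; have := wK y.+1%:Z; rewrite /= (_ : y.+1%:Z - 1 = y%:Z);
  last by lia.
have := pK y.+1%:Z; rewrite (IHy (ltnW ym)) => p1 w1.
have t : top K y.+1%:Z = Num.max (g y) (K y.+1%:Z).
  by rewrite /top (_ : y.+1%:Z - 1 = y%:Z) ?(IHy (ltnW ym)); last by lia.
by case=> -[]; [move/(label_eq0 he) | move/(label_eq1 he)]; rewrite t; lia.
Qed.

Lemma zigzag_of_comb (alpha : nat) : (5 <= w)%N -> (5 <= h)%N -> odd w -> odd h ->
  (h = 1 %[mod 4])%N -> odd alpha -> (3 <= alpha <= w - 2)%N ->
  comb_labels w h alpha eps eta ->
  [/\ n = 2%Z, single_peak F w%:Z 2 & zigzag G h%:Z].
Proof.
move=> w5 h5 ow oh h4 oa a_in [[e0 eh] epsE etaE].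
have [wF [F0 F1] _ bF [c c_in Fc]] := eF; have [wG [G0 G1] _ bG _] := eG.
have n_even : (2 %| n)%Z by have := label_eq0 heps e0;
  rewrite (top_excursion0 eG); lia.
pose g (x : nat) : int := if x == (alpha - 1)%N then 2 else if odd x then 1 else 0.
have Fg : forall x : nat, (x < w)%N -> F x%:Z = g x.
  apply: (walk_of_labels wF heta n_even) => [x||y y_in].
  - exact: excursion_parity eF x.
  - by rewrite /g ifF //; lia.
  have := etaE y ltac:(lia); rewrite !inE /g; case: ifP => yb ->; [left | right];
    split=> //.
    by repeat (case: ifP => ?); lia.
  by repeat (case: ifP => ?); lia.
have Gg : forall y : nat, (y < h)%N -> G y%:Z = wave y.
  apply: (walk_of_labels wG heps n_even) => [x||y y_in].
  - exact: excursion_parity eG x.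
  - by rewrite waveE.
  have := epsE y y_in; rewrite !inE !waveE; case: ifP => yb ->; [left | right];
    split=> //.
    by repeat (case: ifP => ?); lia.
  by repeat (case: ifP => ?); lia.
have Fg' x : 0 <= x < w%:Z -> F x = g (absz x) by move=> ?;
  rewrite -Fg ?gez0_abs; lia.
have n2 : n = 2.
  have := Fg' c c_in; rewrite Fc /g; have := bF (alpha - 1)%N%:Z.
  by rewrite Fg /g ?eqxx; [repeat (case: ifP => ?); lia | lia].
split=> //.
  exists (alpha - 1)%N%:Z; first by lia.
  by move=> x x_in; rewrite Fg' // /g; split; repeat (case: ifP => ?); lia.
have Gg' y : 0 <= y < h%:Z -> G y = wave (absz y) by move=> ?;
  rewrite -Gg ?gez0_abs; lia.
move=> y y_in; rewrite !Gg' ?waveE; try lia.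
by repeat (case: ifP => ? /=); lia.
Qed.

End Labels.

(** * The theorem *)

Section Main.
Variable R : realType.
Implicit Types L : set (R * R).

Lemma labelled_heights (w h : nat) eps eta L : loop_of (label_pattern eps eta) L ->
  L `<=` @region R w h -> has_width L w -> has_height L h ->
  exists F G n v, [/\ looped F G n v w%:Z h%:Z, labels_of eps G n,
    labels_of eta F n,
    finite_set (stitches L) & loop_length L = #|orbit_in w h F G n v|].
Proof.
move=> loopL regL Lw Lh.
have aP := label_pattern_alternating eps eta.
have [F [G [n [v [nm LE]]]]] := loop_normal aP loopL regL Lw Lh.
have lp := normal_looped nm; case: (nm) => -[wF wG] enc lev bS [_ F0 G0].
have [le lt] := encodes_labels enc.
have [fin len] := loop_length_orbit wF wG enc bS LE.
exists F, G, n, v; split=> //.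
  by move=> y; rewrite le F0 add0r.
by move=> x; rewrite lt G0 addr0.
Qed.

Lemma excursion_height_gt0 F (w : nat) n : excursion F w%:Z n -> (2 <= w)%N ->
  1 <= n.
Proof.
move=> [wF [F0 _] _ bF _] w2.
by have := wF 1; have := bF 1; rewrite subrr F0; lia.
Qed.

Lemma walk_lipschitz F x (k : nat) : walk F ->
  F x - k%:Z <= F (x + k%:Z) <= F x + k%:Z.
Proof.
move=> wF; elim: k => [|k IHk]; first by rewrite !addr0 lexx andbT; lia.
have := wF (x + k.+1%:Z).
have -> : F (x + k.+1%:Z - 1) = F (x + k%:Z) by congr F; lia.
by lia.
Qed.

(** A walk over 5 columns from 0 to 0 cannot rise above 2. *)
Lemma excursion5_height F n : excursion F 5 n -> n <= 2.
Proof.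
move=> [wF [F0 F4] _ _ [x x_in Fx]].
have := walk_lipschitz 0 (absz x) wF; have := walk_lipschitz x (absz (4 - x)) wF.
have -> : F (x + (absz (4 - x))%:Z) = 0 by rewrite -F4; congr F; lia.
have -> : F (0 + (absz x)%:Z) = n by rewrite -Fx; congr F; lia.
by rewrite F0 Fx; lia.
Qed.

Lemma loop_labelled (w h : nat) L : hitomezashi_loop L -> has_width L w ->
  has_height L h ->
  exists eps eta L0 v, [/\ loop_of (label_pattern eps eta) L0,
    L0 `<=` @region R w h,
    has_width L0 w, has_height L0 h & L = translate v L0].
Proof.
move=> [P /hitomezashi_alternating aP loopL] Lw Lh.
have [v [F [G [l [wF wG enc lev [LE [N bN]]]]]]] := loop_orbit aP loopL.
have [x0 [x1 [y0 [y1 bS]]]] := bbox_exists (fun Q stQ (Qv : Q v) => Qv) bN.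
have ew := width_bbox wF wG enc bS LE Lw.
have eh := height_bbox wF wG enc bS LE Lh.
pose a := opp_vec (x0, y0).
have [eps [eta eP]] := alternating_labels (alternating_translate a aP).
exists eps, eta, (translate a L), (x0, y0); split.
- by rewrite -eP; exact: loop_of_translate.
- move=> _ [[p q] Lpq <-]; move: Lpq;
    rewrite {1}LE => -[s /(orbit_bounds wF wG enc bS)].
  move=> [[/andP[s1 _] /andP[_ s2]] [/andP[s3 _] /andP[_ s4]]] [/= sp sq].
  move: s1 s2 s3 s4 sp sq; rewrite /region /a /= !intrN -!(ler_int R).
  have -> : w%:R = x1%:~R - x0%:~R :> R by rewrite -intrB ew.
  have -> : h%:R = y1%:~R - y0%:~R :> R by rewrite -intrB eh.
  by lra.
- exact: has_width_translate.
- exact: has_height_translate.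
- by rewrite translateK.
Qed.

Lemma finite_translate v L : finite_set (stitches L) ->
  finite_set (stitches (translate v L)).
Proof. by rewrite stitches_translate; exact: finite_image. Qed.

Lemma labelled_loop_size (w h : nat) (lab : (int -> 'Z_2) -> (int -> 'Z_2) ->
  Prop) L :
  labelled_loop w h lab L ->
  [/\ has_width L w, has_height L h & exists eps eta F G n v,
    [/\ lab eps eta, looped F G n v w%:Z h%:Z, labels_of eps G n,
      labels_of eta F n &
      finite_set (stitches L) /\ loop_length L = #|orbit_in w h F G n v|]].
Proof.
move=> [eps [eta [L0 [v [labs loop reg [Lw Lh] ->]]]]].
have [F [G [n [u [lp le lt fin len]]]]] := labelled_heights loop reg Lw Lh.
split; [exact: has_width_translate | exact: has_height_translate |].
exists eps, eta, F, G, n, u; split=> //; split; first exact: finite_translate.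
by rewrite loop_length_translate.
Qed.

Lemma wand5_size L : wand_of_width5 L -> exists h : nat,
  [/\ has_width L 5, has_height L h, finite_set (stitches L) &
    loop_length L = ((5 - 1) * (h - 1) + 4)%N].
Proof.
move=> [h [oh h5 /labelled_loop_size[Lw Lh]]].
move=> [eps [eta [F [G [n [v [labs lp le lt [fin len]]]]]]]].
exists h; split=> //; have [eF eG _ _] := lp.
have [n2 pk] := peak_of_wand eF lt erefl labs.
have [_ eq_len] := length_extremal lp isT h5 ltac:(lia).
by rewrite len; apply/eq_len; split=> //; left; split=> //; left.
Qed.

Lemma wand_of_height2 (h : nat) eps eta L F G v :
  loop_of (label_pattern eps eta) L -> L `<=` @region R 5 h ->
  has_width L 5 -> has_height L h -> odd h -> (5 <= h)%N ->
  looped F G 2 v 5 h%:Z -> labels_of eps G 2 -> labels_of eta F 2 ->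
  forall u, wand_of_width5 (translate u L).
Proof.
move=> loop reg Lw Lh oh h5 [eF eG _ _] le lt u.
exists h; split=> //; exists eps, eta, L, u; split=> //.
exact: (@wand_labels_of_height2 5 h F G 2 eps eta).
Qed.

(** Rotated back, the loop has width 5, so the maximum [n1] of its heights is 1
    or 2.  The label of the bottom line of the rotated loop is that of the
    right side of [L], so [n1] is even like 2. *)
Lemma rotated_wand_of_height2 (w : nat) eps eta L F G v :
  loop_of (label_pattern eps eta) L -> L `<=` @region R w 5 ->
  has_width L w -> has_height L 5 -> odd w -> (5 <= w)%N ->
  looped F G 2 v w%:Z 5 -> labels_of eps G 2 -> labels_of eta F 2 ->
  forall u, wand_of_height5 (translate u L).
Proof.
move=> loop reg Lw Lh ow w5 [eF eG _ _] le lt u.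
pose L1 := translate (0, w%:Z) (@unrot_point R @` L).
pose P1 := shift_stitch (0, w%:Z) @` (unrot_stitch @` label_pattern eps eta).
have loop1 : loop_of P1 L1 by apply: loop_of_translate; apply: loop_of_unrot.
have a1 : alternating P1.
  by apply: alternating_translate; apply: alternating_unrot;
    exact: label_pattern_alternating.
have [eps1 [eta1 eP1]] := alternating_labels a1.
have reg1 : L1 `<=` @region R 5 w.
  move=> _ [_ [[p q] /reg[/= h1 h2] <-] <-] /=; rewrite addr0.
  by split=> //=; move: h1; rewrite -pmulrn; lra.
have Lw1 : has_width L1 5 by apply: has_width_translate; apply: has_width_unrot.
have Lh1 : has_height L1 w by apply: has_height_translate; apply: has_height_unrot.
rewrite eP1 in loop1.
have [F1 [G1 [n1 [v1 [lp1 le1 lt1 _ _]]]]] := labelled_heights loop1 reg1 Lw1 Lh1.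
have [eF1 eG1 _ _] := lp1.
have n1_even : (2 %| n1)%Z.
  have : P1 (true, (0, 0)).
    rewrite /P1 shift_stitchE unrot_stitchE /shift_stitch /rot_stitch /opp_vec
      /label_pattern /=.
    by rewrite !sub0r opprK oppr0 lt (top_excursion_last eF).
  rewrite eP1 /label_pattern /= => /esym/(label_eq0 le1).
  by rewrite (top_excursion0 eG1); lia.
have n12 : n1 = 2.
  by have := excursion5_height eF1; have := excursion_height_gt0 eF1 isT; lia.
subst n1; exists L1.
  have := wand_of_height2 loop1 reg1 Lw1 Lh1 ow w5 lp1 le1 lt1 (0, 0).
  suff -> : translate (0, 0) L1 = L1 by [].
  rewrite translateE (_ : shift_point _ = id) ?image_id //.
  by apply/funext => -[p q]; rewrite /shift_point /= !addr0.
exists (w%:Z + u.1, u.2).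
rewrite rotate90E /L1 !translateE !image_comp; congr (_ @` _).
apply/funext => -[p q]; rewrite /shift_point /rot_point /unrot_point /= !intrD
  addr0.
by congr pair; lra.
Qed.

End Main.

Local Open Scope nat_scope.

Theorem theorem2p6 (R : realType) (w h : nat) (L : set (R * R))
  (w_odd : odd w) (h_odd : odd h) (w_ge5 : 5 <= w) (h_ge5 : 5 <= h)
  (L_loop : hitomezashi_loop L) (L_width : has_width L w)
  (L_height : has_height L h) (L_not_rug : ~ rug L) :
  loop_length L <= (w - 1) * (h - 1) + 4 /\
  (loop_length L = (w - 1) * (h - 1) + 4 <->
     horizontal_comb L \/ vertical_comb L \/ (minn w h = 5 /\ wand L)).
Proof.
have [eps [eta [L0 [u [loop reg Lw Lh LE]]]]] :=
  loop_labelled L_loop L_width L_height.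
have [F [G [n [v [lp le lt fin len]]]]] := labelled_heights loop reg Lw Lh.
have [eF eG _ _] := lp.
have n_ge2 : (2 <= n)%R.
  have := excursion_height_gt0 eF ltac:(lia).
  have [n1|] := eqVneq n 1%R; last by lia.
  case: L_not_rug; exists w, h; split=> //; exists eps, eta, L0, u; split=> //.
  exact: (rug_labels_of_height1 eF eG le lt n1).
have [bound eq_len] := length_extremal lp w_ge5 h_ge5 n_ge2.
have lenL : loop_length L = #|orbit_in w h F G n v|
  by rewrite LE loop_length_translate.
split; first by rewrite lenL.
split.
  rewrite lenL => /eq_len[n2 cases]; subst n.
  case: cases => -[pk [e5|zz]].
  - subst w; right; right; split; first by rewrite (minn_idPl h_ge5).
    by left; rewrite LE; exact: (wand_of_height2 loop reg Lw Lh h_odd h_ge5 lp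
      le lt).
  - have [alpha [h4 a_in labs]] := comb_of_zigzag eF eG le lt erefl w_ge5 h_ge5
      w_odd h_odd pk zz.
    by left; exists w, h, alpha; split=> //; exists eps, eta, L0, u.
  - subst h; right; right; split; first by rewrite (minn_idPr w_ge5).
    by right; rewrite LE; exact:
      (rotated_wand_of_height2 loop reg Lw Lh w_odd w_ge5 lp le lt).
  - have [beta [w4 b_in labs]] := comb_of_zigzag eG eF lt le erefl h_ge5 w_ge5
      h_odd w_odd pk zz.
    by right; left; exists w, h, beta; split=> //; exists eps, eta, L0, u.
case=> [[w' [h' [alpha [_ _ h4 [oa a_in] /labelled_loop_size[Lw' Lh' ]]]]]|].
  have ew := has_width_uniq L_width Lw'; have eh := has_height_uniq L_height Lh';
    subst w' h'.
  move=> [eps' [eta' [F' [G' [n' [v' [labs lp' le' lt' [_ ->]]]]]]]].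
  have [eF' eG' _ _] := lp'.
  have [n2 pk zz] := zigzag_of_comb eF' eG' le' lt' w_ge5 h_ge5 w_odd h_odd h4
    oa a_in labs.
  have [_ eq'] := length_extremal lp' w_ge5 h_ge5 ltac:(lia).
  by apply/eq'; split=> //; left; split=> //; right.
case=> [[w' [h' [beta [_ _ w4 [ob b_in] /labelled_loop_size[Lw' Lh' ]]]]]|].
  have ew := has_width_uniq L_width Lw'; have eh := has_height_uniq L_height Lh';
    subst w' h'.
  move=> [eps' [eta' [F' [G' [n' [v' [labs lp' le' lt' [_ ->]]]]]]]].
  have [eF' eG' _ _] := lp'.
  have [n2 pk zz] := zigzag_of_comb eG' eF' lt' le' h_ge5 w_ge5 h_odd w_odd w4
    ob b_in labs.
  have [_ eq'] := length_extremal lp' w_ge5 h_ge5 ltac:(lia).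
  by apply/eq'; split=> //; right; split=> //; right.
case=> _ [/wand5_size[h' [Lw' Lh' _ ->]]|[L1 /wand5_size[h' [Lw' Lh' fin' len']]
  [a e]]].
  by rewrite (has_width_uniq L_width Lw') (has_height_uniq L_height Lh').
have Lh5 : has_height L 5 by rewrite e; apply: has_height_translate;
  exact: has_height_rot.
have Lwh : has_width L h' by rewrite e; apply: has_width_translate;
  exact: has_width_rot.
rewrite (has_width_uniq L_width Lwh) (has_height_uniq L_height Lh5) mulnC -len' e.
rewrite loop_length_translate ?loop_length_rot //.
by rewrite stitches_rot; exact: finite_image.
Qed.
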